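(* Let $\Omega\subset\mathbb{R}^n$ be a bounded domain and let $(u,v)$ solve $$u_t=d_1\Delta u+a_1u-b_1u^2-c_1uv,\qquad v_t=d_2\Delta v+\frac{a_2v}{1+k(x)u}-b_2v^2-c_2uv\quad\text{in }\Omega\times(0,\infty),$$ with $\partial_\nu u=\partial_\nu v=0$ on $\partial\Omega$, positive constant initial data with $u(x,0)\ge1$, such that $u$ increases monotonically in time to its limit $u^*$, where $k$ satisfies the standing assumptions below. Suppose that for $k\equiv0$ the system is in the weak competition setting ($\frac{c_2}{b_1}<\frac{a_2}{a_1}<\frac{b_2}{c_1}$ and $b_1b_2>c_1c_2$). Let $k_c=\frac{a_2b_1^2-c_2a_1b_1}{a_1^2c_2}$. Then there is a constant $C_1>0$, depending only on $\Omega$ and the parameters (not on the initial data or on $x$), such that if $$\frac{C_1}{|\Omega|}\int_\Omega\frac{1}{1+k(x)}\,dx<\frac{1}{1+k_c\frac{a_1}{b_1}},$$ then $(u,v)$ converges uniformly on $\Omega$ to $(\frac{a_1}{b_1},0)$ as $t\to\infty$.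
   Context: Standing assumptions on $k$: $k\in C^1(\overline\Omega)$, $k\ge0$, and $k$ vanishes only on a set of Lebesgue measure zero. All parameters $a_i,b_i,c_i,d_i$ are positive. *)

(* Defs.v *)
From HB Require Import structures.
From mathcomp Require Import all_boot all_order all_algebra.
From mathcomp Require Import all_classical all_reals all_analysis.
Set Implicit Arguments. Unset Strict Implicit. Unset Printing Implicit Defensive.
Import Order.TTheory GRing.Theory Num.Theory.
Import numFieldNormedType.Exports.
Local Open Scope classical_set_scope.
Local Open Scope ring_scope.

Definition ebasis {R : realType} {n : nat} (i : 'I_n) : 'rV[R]_n := delta_mx 0 i.

Definition pder {R : realType} {n : nat} (i : 'I_n) (f : 'rV[R]_n -> R) : 'rV[R]_n -> R :=
  fun x => 'D_(ebasis i) f x.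
Definition laplacian {R : realType} {n : nat} (f : 'rV[R]_n -> R) (x : 'rV[R]_n) : R :=
  \sum_(i < n) pder i (pder i f) x.
Definition gradient {R : realType} {n : nat} (f : 'rV[R]_n -> R) (x : 'rV[R]_n) : 'rV[R]_n :=
  \row_(i < n) pder i f x.

(* phi : R^n -> R is a C^1 global defining function of Omega:
   Omega = {phi < 0}, grad phi continuous and nonzero on {phi = 0}.
   Then the outward normal at a boundary point x is grad phi x / |grad phi x|. *)
Definition defining_function {R : realType} {n : nat} (Omega : set 'rV[R]_n)
  (phi : 'rV[R]_n -> R) : Prop :=
  (forall x, differentiable phi x) /\
  (forall i : 'I_n, continuous (pder i phi)) /\
  Omega = [set x | phi x < 0] /\
  (forall x, phi x = 0 -> gradient phi x != 0).

Definition bounded_C1_domain {R : realType} {n : nat} (Omega : set 'rV[R]_n) : Prop :=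
  open Omega /\ connected Omega /\ Omega !=set0 /\ bounded_set Omega /\
  exists phi, defining_function Omega phi.

(* Homogeneous Neumann condition at the boundary point x for w : R^n -> R,
   classical sense: the one-sided (from inside) derivative of w at x in the
   direction of the outward normal grad phi x vanishes, for any defining function
   (the normal direction does not depend on the choice of phi). *)
Definition neumann_at {R : realType} {n : nat} (Omega : set 'rV[R]_n)
  (w : 'rV[R]_n -> R) (x : 'rV[R]_n) : Prop :=
  forall phi, defining_function Omega phi -> phi x = 0 ->
    (fun h : R => h^-1 * (w x - w (x - h *: gradient phi x))) @ 0^'+ --> 0.

(* identification of n.-tuples (with their product sigma-algebra) with R^n *)
Definition tup2rV {R : realType} {n : nat} (t : n.-tuple R) : 'rV[R]_n :=
  \row_(i < n) tnth t i.

(* lam is n-dimensional Lebesgue measure (on the Borel sets of R^n = n.-tuple R):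
   the measure of every closed box is the product of its side lengths.  This
   determines the measure uniquely. *)
Definition is_lebesgue_measure {R : realType} {n : nat}
  (lam : {measure set (n.-tuple R) -> \bar R}) : Prop :=
  forall a b : n.-tuple R, (forall i, tnth a i <= tnth b i) ->
    lam [set t | forall i, tnth a i <= tnth t i <= tnth b i] =
    (\prod_(i < n) (tnth b i - tnth a i))%:E.

(* k in C^1(closure Omega) (via a C^1 extension), k >= 0, and k vanishes only on
   a Lebesgue null set *)
Definition standing_k {R : realType} {n : nat} (Omega : set 'rV[R]_n)
  (lam : {measure set (n.-tuple R) -> \bar R}) (k : 'rV[R]_n -> R) : Prop :=
  (forall x, closure Omega x -> differentiable k x) /\
  (forall i : 'I_n, {within closure Omega, continuous (pder i k)}) /\
  (forall x, closure Omega x -> 0 <= k x) /\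
  lam (tup2rV @^-1` (Omega `&` [set x | k x = 0])) = 0%E.

Definition C21_sol {R : realType} {n : nat} (Omega : set 'rV[R]_n)
  (w : 'rV[R]_n -> R -> R) : Prop :=
  {within closure Omega `*` [set t | 0 <= t], continuous (fun p => w p.1 p.2)} /\
  (forall x t, Omega x -> 0 < t ->
     derivable (w x) t 1 /\
     (forall i, derivable (w ^~ t) x (ebasis i)) /\
     (forall i, derivable (pder i (w ^~ t)) x (ebasis i))) /\
  {within Omega `*` [set t | 0 < t], continuous (fun p => derive1 (w p.1) p.2)} /\
  (forall i, {within Omega `*` [set t | 0 < t],
     continuous (fun p => pder i (pder i (w ^~ p.2)) p.1)}) /\
  (forall t, 0 < t -> forall x, (closure Omega `\` Omega) x -> neumann_at Omega (w ^~ t) x).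

Definition solves_system {R : realType} {n : nat} (Omega : set 'rV[R]_n)
  (k : 'rV[R]_n -> R) (a1 a2 b1 b2 c1 c2 d1 d2 : R) (u v : 'rV[R]_n -> R -> R) : Prop :=
  C21_sol Omega u /\ C21_sol Omega v /\
  (forall x t, Omega x -> 0 < t ->
     derive1 (u x) t = d1 * laplacian (u ^~ t) x + a1 * u x t - b1 * u x t ^+ 2
                       - c1 * u x t * v x t) /\
  (forall x t, Omega x -> 0 < t ->
     derive1 (v x) t = d2 * laplacian (v ^~ t) x + a2 * v x t / (1 + k x * u x t)
                       - b2 * v x t ^+ 2 - c2 * u x t * v x t).

(* Main.v *)
(** Since [u] increases in time, [1 <= u], so [v] is a subsolution of
    [v_t = d2 Lap v + (a2 f - c2) v] with [f = 1 / (1 + k)].  Everything is done with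
    the maximum principle, by barriers of the form [S x * s t].  The hypothesis, with
    [C1] large, says that the integral of [f] is small; since [0 <= f <= 1], the
    Newtonian potential of [f] and its gradient are then uniformly small, because the
    fundamental solution and its gradient are locally integrable.  Adding a small
    multiple of a function increasing towards the boundary gives [Phi] with
    [|Phi| <= kappa], [Lap Phi <= kappa - f] and positive outward derivative, and
    [S = 1 + (4 a2 / d2) Phi] is a strict supersolution, which forces [v] to [0].
    Comparison with spatially almost constant barriers then gives the limit of [u].

    Two devices keep this elementary.  The potential is a finite sum of regularised
    fundamental solutions over a fine lattice, whose step depends on the modulus of
    continuity of [f] while the estimates do not.  The domain being only C^1, the
    boundary function is an infimal convolution of the defining function, which is
    tested against touching paraboloids instead of being differentiated. *)

Require Import Defs.
From HB Require Import structures.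
From mathcomp Require Import all_boot all_order all_algebra.
From mathcomp Require Import all_classical all_reals all_analysis.
From mathcomp Require Import ring lra.
Set Implicit Arguments. Unset Strict Implicit. Unset Printing Implicit Defensive.
Import Order.TTheory GRing.Theory Num.Theory.
Import numFieldNormedType.Exports.
Local Open Scope classical_set_scope.
Local Open Scope ring_scope.

Section line_calculus.
Context {R : realType}.
Implicit Types (F Q : R -> R) (a d l r : R).

Lemma is_derive1_slope F a d : is_derive a 1 F d ->
  forall e, 0 < e -> exists2 dl : R, 0 < dl &
    forall h, `|h| < dl -> h != 0 -> `|h^-1 * (F (a + h) - F a) - d| < e.
Proof.
move=> [+ <-] e e0; rewrite /derivable /derive => dF.
have /cvgrPdist_lt/(_ e e0) : h^-1 *: ((F \o shift a) (h *: 1) - F a) @[h --> 0^'] -->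
  lim (h^-1 *: ((F \o shift a) (h *: 1) - F a) @[h --> 0^']) by [].
rewrite /dnbhs near_withinE => /nbhs_ballP[dl /= dl0 H].
exists dl => // h hd hn0; have := H h; rewrite /ball /= sub0r normrN => /(_ hd hn0).
by rewrite distrC /= /GRing.scale /= mulr1 [h + a]addrC.
Qed.

Lemma is_derive1_left_max F a d b : is_derive a 1 F d -> b < a ->
  (forall t, b < t < a -> F t <= F a) -> 0 <= d.
Proof.
move=> /is_derive1_slope dF ba Fle; rewrite leNgt; apply/negP => d0.
have [|dl dl0 H] := dF (- d); first by rewrite oppr_gt0.
pose h := - Num.min (dl / 2) ((a - b) / 2).
have m0 : 0 < Num.min (dl / 2) ((a - b) / 2).
  by rewrite lt_min; apply/andP; split; lra.
have hl : `|h| < dl by rewrite normrN gtr0_norm// gt_min; apply/orP; left; lra.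
have hb : - ((a - b) / 2) <= h by rewrite lerN2 ge_min lexx orbT.
have h0 : h < 0 by rewrite oppr_lt0.
have := H h hl (ltr0_neq0 h0).
rewrite ltr_norml => /andP[_].
have : F (a + h) <= F a by apply: Fle; lra.
have : 0 <= h^-1 * (F (a + h) - F a) \/ F (a + h) > F a.
  have [?|?] := leP (F (a + h)) (F a); [left|by right].
  by apply: mulr_le0; rewrite ?invr_le0 ?(ltW h0)// subr_le0.
by move=> [] + +; lra.
Qed.

Lemma is_derive1_within_continuous F (dF : R -> R) a b :
  (forall x, a <= x <= b -> is_derive x 1 F (dF x)) ->
  {within `[a, b], continuous F}.
Proof.
move=> H; apply: derivable_within_continuous => x.
by rewrite in_itv/= => /H [].
Qed.

Definition C2at0 Q l := exists Q1 : R -> R,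
  (exists2 dl : R, 0 < dl & forall r, `|r| < dl -> is_derive r 1 Q (Q1 r)) /\
  is_derive (0 : R) 1 Q1 l.

Lemma C2at0_local_max Q l dl : C2at0 Q l -> 0 < dl ->
  (forall r, `|r| < dl -> Q r <= Q 0) -> l <= 0.
Proof.
move=> [Q1 [[d1 d10 dQ] /is_derive1_slope dQ1]] dl0 Qm.
rewrite leNgt; apply/negP => l0.
have [d2 d20 H] := dQ1 _ l0.
pose h := Num.min (Num.min d1 d2) dl / 2.
have m0 : 0 < Num.min (Num.min d1 d2) dl by rewrite !lt_min d10 d20.
have m1 : Num.min (Num.min d1 d2) dl <= d1 by rewrite !ge_min lexx.
have m2 : Num.min (Num.min d1 d2) dl <= d2 by rewrite !ge_min lexx !orbT.
have m3 : Num.min (Num.min d1 d2) dl <= dl by rewrite !ge_min lexx !orbT.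
have h0 : 0 < h by rewrite /h; lra.
have hl : h < d1 /\ h < d2 /\ h < dl by rewrite /h; lra.
have pos r : `|r| < d2 -> r != 0 -> 0 < r^-1 * (Q1 r - Q1 0).
  by move=> rd rn0; have := H r rd rn0; rewrite add0r ltr_norml; lra.
have [Q10|Q10] := leP 0 (Q1 0).
- have dQh x : 0 <= x <= h -> is_derive x 1 Q (Q1 x).
    by move=> xh; apply: dQ; rewrite ltr_norml; lra.
  have [c|c] := MVT (df := Q1) h0 _ (is_derive1_within_continuous dQh).
    by rewrite in_itv/= => ch; apply: dQh; lra.
  rewrite in_itv/= => ch.
  have /pos : `|c| < d2 by rewrite ltr_norml; lra.
  have c0 : 0 < c by lra.
  move=> /(_ (lt0r_neq0 c0)); rewrite pmulr_rgt0 ?invr_gt0// => Qc.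
  have : 0 < Q1 c * (h - 0) by apply: mulr_gt0; lra.
  have : Q h <= Q 0 by apply: Qm; rewrite ltr_norml; lra.
  lra.
- have dQh x : - h <= x <= 0 -> is_derive x 1 Q (Q1 x).
    by move=> xh; apply: dQ; rewrite ltr_norml; lra.
  have Nh0 : - h < 0 by lra.
  have [c|c] := MVT (df := Q1) Nh0 _ (is_derive1_within_continuous dQh).
    by rewrite in_itv/= => ch; apply: dQh; lra.
  rewrite in_itv/= => ch.
  have /pos : `|c| < d2 by rewrite ltr_norml; lra.
  have c0 : c < 0 by lra.
  move=> /(_ (ltr0_neq0 c0)); rewrite nmulr_rgt0 ?invr_lt0// => Qc.
  have : 0 < - Q1 c * (0 - - h) by apply: mulr_gt0; lra.
  have : Q (- h) <= Q 0 by apply: Qm; rewrite ltr_norml; lra.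
  lra.
Qed.

Lemma C2at0_eq Q Q' l l' : C2at0 Q l -> Q =1 Q' -> l = l' -> C2at0 Q' l'.
Proof. by move=> + /funext <- <-. Qed.

Lemma C2at0_cst a : C2at0 (cst a) 0.
Proof.
exists (cst 0); split; last exact: is_derive_cst.
by exists 1 => // r _; exact: is_derive_cst.
Qed.

Lemma C2at0D Q Q' l l' : C2at0 Q l -> C2at0 Q' l' ->
  C2at0 (fun r => Q r + Q' r) (l + l').
Proof.
move=> [Q1 [[d d0 dQ] dQ1]] [Q1' [[d' d'0 dQ'] dQ1']].
exists (Q1 + Q1'); split; last exact: is_deriveD.
exists (Num.min d d'); first by rewrite lt_min d0.
move=> r; rewrite lt_min => /andP[rd rd'].
by apply: is_deriveD; [exact: dQ|exact: dQ'].
Qed.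

Lemma C2at0Z Q l a : C2at0 Q l -> C2at0 (fun r => a * Q r) (a * l).
Proof.
move=> [Q1 [[d d0 dQ] dQ1]].
exists (a *: Q1); split; last exact: is_deriveZ.
by exists d => // r /dQ; exact: is_deriveZ.
Qed.

Lemma C2at0N Q l : C2at0 Q l -> C2at0 (fun r => - Q r) (- l).
Proof.
move=> /(C2at0Z (-1)) H; apply: (C2at0_eq H) => [r|]; by rewrite mulN1r.
Qed.

Lemma C2at0_sum (I : Type) (s : seq I) (Q : I -> R -> R) (l : I -> R) :
  (forall i, C2at0 (Q i) (l i)) ->
  C2at0 (fun r => \sum_(i <- s) Q i r) (\sum_(i <- s) l i).
Proof.
move=> H; elim: s => [|i s IH].
  by apply: (C2at0_eq (C2at0_cst 0)) => [r|]; rewrite big_nil.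
by apply: (C2at0_eq (C2at0D (H i) IH)) => [r|]; rewrite big_cons.
Qed.

End line_calculus.

Section within_continuity.
Context {R : realType} {T : pseudoMetricType R}.
Implicit Types (A : set T) (f : T -> R).

Lemma within_continuous_ballP A f : {within A, continuous f} <->
  (forall x, A x -> forall e, 0 < e -> exists2 dl : R, 0 < dl &
     forall y, A y -> ball x dl y -> `|f x - f y| < e).
Proof.
split=> [cf x Ax e e0|cf x].
  have /cvgrPdist_lt/(_ e e0) : f @ (x : subspace A) --> f x by exact: cf.
  rewrite {1}/nbhs/= -nbhs_subspace_in// near_withinE => /nbhs_ballP[dl /= dl0 H].
  by exists dl => // y Ay /H; exact.
apply/cvgrPdist_lt => e e0.
have [Ax|nAx] := pselect (A x).
  rewrite -nbhs_subspace_in//.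
  have [dl dl0 H] := cf x Ax e e0.
  rewrite near_withinE; apply/nbhs_ballP; exists dl => //= y xy Ay.
  exact: H.
by rewrite -nbhs_subspace_out// => y /= ->; rewrite subrr normr0.
Qed.

Lemma compact_within_le0 A f : compact A -> {within A, continuous f} ->
  compact (A `&` [set x | f x <= 0]).
Proof.
move=> cA cf.
have /closed_subspaceP[V cV VA] : closed ([set x | f x <= 0] : set (subspace A)).
  rewrite (_ : [set x | f x <= 0] = f @^-1` [set y | y <= 0])//.
  by move/continuous_closedP : cf; apply; exact: closed_le.
by rewrite setIC -VA setIC; exact: compact_closedI.
Qed.

End within_continuity.

Section comparison_principle.
Context {R : realType} {n : nat}.
Notation V := 'rV[R]_n.
Implicit Types (Omega : set V) (S L : V -> R) (w wt lap : V -> R -> R) (N : V -> V).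

(* [N] stands for a field of outward directions on the boundary. *)
Record regular Omega N w wt lap : Prop := Regular {
  reg_cont : {within closure Omega `*` [set t | 0 <= t],
                continuous (fun p => w p.1 p.2)} ;
  reg_time : forall x (t : R), Omega x -> 0 < t -> is_derive t 1 (w x) (wt x t) ;
  reg_space : forall x (t : R), Omega x -> 0 < t -> exists l : 'I_n -> R,
    lap x t = \sum_i l i /\
    forall i, C2at0 (fun r => w (x + r *: ebasis i) t) (l i) ;
  reg_neumann : forall x (t : R), closure Omega x -> ~ Omega x -> 0 < t ->
    forall e, 0 < e -> exists2 dl : R, 0 < dl & forall h, 0 < h < dl ->
      `|h^-1 * (w x t - w (x - h *: N x) t)| < e }.

(* An upper bound for the Laplacian of [S] at [x] in the viscosity sense, tested
   on the coordinate lines only. *)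
Definition touched_above S x (c : R) := exists l : 'I_n -> R,
  \sum_i l i <= c /\ forall i, exists2 Q, C2at0 Q (l i) &
    Q 0 = S x /\ forall r, S (x + r *: ebasis i) <= Q r.

Definition increases_along S x (p : V) := exists (Q : R -> R) (c : R), [/\ 0 < c,
  is_derive (0 : R) 1 Q (- c), Q 0 = S x & forall r, S (x - r *: p) <= Q r].

Lemma regularN Omega N w wt lap : regular Omega N w wt lap ->
  regular Omega N (fun x t => - w x t) (fun x t => - wt x t) (fun x t => - lap x t).
Proof.
move=> [cw dw sw nw]; split.
- apply/within_continuous_ballP => p Ap e e0.
  have [dl dl0 H] := (within_continuous_ballP _ _).1 cw p Ap e e0.
  by exists dl => // q Aq pq; rewrite -opprD normrN; exact: H.
- by move=> x t Ox t0; apply: is_deriveN; exact: dw.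
- move=> x t Ox t0; have [l [-> H]] := sw x t Ox t0.
  exists (fun i => - l i); split; first by rewrite sumrN.
  by move=> i; exact: C2at0N.
- move=> x t cx nx t0 e e0; have [dl dl0 H] := nw x t cx nx t0 e e0.
  by exists dl => // h hd; rewrite -opprD mulrN normrN; exact: H.
Qed.

Lemma open_line Omega x (p : V) : open Omega -> Omega x ->
  exists2 dl : R, 0 < dl & forall r, `|r| < dl -> Omega (x + r *: p).
Proof.
move=> oO Ox; have /nbhs_ballP[e /= e0 H] : nbhs x Omega by exact: open_nbhs_nbhs.
have p0 : 0 < `|p| + 1 by rewrite ltr_wpDl.
exists (e / (`|p| + 1)); first by rewrite divr_gt0.
move=> r; rewrite ltr_pdivlMr// => rp; apply: H.
rewrite -ball_normE /ball_ /= opprD addNKr normrN normrZ.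
by apply: le_lt_trans rp; rewrite ler_wpM2l// lerDl.
Qed.

Variables (Omega : set V) (N : V -> V) (w wt lap : V -> R -> R).
Hypotheses (oO : open Omega) (cO : compact (closure Omega)).
Hypothesis N_inward : forall x, closure Omega x -> ~ Omega x ->
  exists2 dl : R, 0 < dl & forall h, 0 < h < dl -> Omega (x - h *: N x).
Hypothesis wP : regular Omega N w wt lap.

Variables (S L : V -> R) (s ds : R -> R) (T : R).
Hypothesis S_cont : {within closure Omega, continuous S}.
Hypothesis s_cont : continuous s.
Hypothesis s_gt0 : forall t : R, 0 <= t <= T -> 0 < s t.
Hypothesis s_der : forall t : R, 0 < t <= T -> is_derive t 1 s (ds t).
Hypothesis S_above : forall x, Omega x -> touched_above S x (L x).
Hypothesis S_incr : forall x, closure Omega x -> ~ Omega x -> increases_along S x (N x).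
Hypothesis w0 : forall x, closure Omega x -> w x 0 < S x * s 0.
Hypothesis no_contact : forall x t, Omega x -> 0 < t <= T -> w x t = S x * s t ->
  S x * ds t <= wt x t -> lap x t <= s t * L x -> False.

Let K := closure Omega `*` `[0, T]%classic.
Let G (p : V * R) := S p.1 * s p.2 - w p.1 p.2.

Let G_cont : {within K, continuous G}.
Proof.
have sub : K `<=` closure Omega `*` [set t | 0 <= t].
  by move=> [x t] [/= cx]; rewrite in_itv/= => /andP[t0 _].
have cS : {within K, continuous (fun p => S p.1)}.
  apply/within_continuous_ballP => -[x t] [/= cx tT] e e0.
  have [dl dl0 H] := (within_continuous_ballP _ _).1 S_cont x cx e e0.
  by exists dl => // -[y t'] [/= cy _] [/= xy _]; exact: H.
have cs : {within K, continuous (fun p : V * R => s p.2)}.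
  apply: continuous_subspaceT => p.
  by apply: (@continuous_comp _ _ _ snd s); [exact: cvg_snd|exact: s_cont].
have cw := continuous_subspaceW sub (reg_cont wP).
move=> p; apply: cvgB; last exact: cw.
by apply: cvgM; [exact: cS|exact: cs].
Qed.

Lemma comparison x t : closure Omega x -> 0 <= t <= T -> w x t < S x * s t.
Proof.
move=> cx tT; rewrite ltNge; apply/negP => Swx.
have cK : compact (K `&` [set p | G p <= 0]).
  apply: compact_within_le0 => //; apply: compact_setX => //.
  exact: segment_compact.
have [||[x0 t0] /=] := @compact_EVT_min _ _ (fun p : V * R => p.2) _ _ cK.
- by exists (x, t); split => /=; [split; rewrite //= in_itv|rewrite /G subr_le0].
- by apply: continuous_subspaceT => p; exact: cvg_snd.
rewrite inE => -[[/= cx0]]; rewrite in_itv/= => t0T; rewrite /G/= subr_le0 => Sw0 tmin.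
have before y r : closure Omega y -> 0 <= r < t0 -> w y r < S y * s r.
  move=> cy rt; rewrite ltNge; apply/negP => Swy.
  suff : t0 <= r by lra.
  have := tmin (y, r); rewrite /= inE; apply; split => /=.
    by split => //=; rewrite in_itv/=; lra.
  by rewrite subr_le0.
have t00 : 0 < t0.
  rewrite lt_neqAle; apply/andP; split; last by lra.
  by apply/eqP => t00; have := w0 cx0; rewrite t00; lra.
have at_t0 y : closure Omega y -> w y t0 <= S y * s t0.
  move=> cy; rewrite leNgt; apply/negP => Swy.
  have e0 : 0 < w y t0 - S y * s t0 by lra.
  have Ky r : 0 <= r <= t0 -> K (y, r).
    by move=> rt; split => //=; rewrite in_itv/=; lra.
  have Kyt : K (y, t0) by apply: Ky; lra.
  have [dl dl0 H] := (within_continuous_ballP _ _).1 G_cont (y, t0) Kyt _ e0.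
  pose r := t0 - Num.min (dl / 2) (t0 / 2).
  have m0 : 0 < Num.min (dl / 2) (t0 / 2) by rewrite lt_min; apply/andP; split; lra.
  have m1 : Num.min (dl / 2) (t0 / 2) <= dl / 2 by rewrite ge_min lexx.
  have m2 : Num.min (dl / 2) (t0 / 2) <= t0 / 2 by rewrite ge_min lexx orbT.
  have Kyr : K (y, r) by apply: Ky; rewrite /r; lra.
  have /(H _ Kyr) : ball (y, t0) dl (y, r).
    split => /=; first exact: ballxx.
    by rewrite -ball_normE /ball_/= /r opprB addrC subrK gtr0_norm//; lra.
  rewrite /G/= ltr_norml => /andP[+ _].
  have : w y r < S y * s r by apply: before => //; rewrite /r; lra.
  lra.
have weq : w x0 t0 = S x0 * s t0 by apply/eqP; rewrite eq_le Sw0 at_t0.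
have st0 : 0 < s t0 by exact: s_gt0.
have [Ox0|nOx0] := pselect (Omega x0).
  have [l [lapE Hl]] := reg_space wP Ox0 t00.
  have [m [mL Hm]] := S_above Ox0.
  apply: (no_contact Ox0 _ weq); first by rewrite t00/=; lra.
  - have := is_deriveB (reg_time wP Ox0 t00) (is_deriveZ (S x0) (s_der _)).
    have tt : 0 < t0 <= T by lra.
    move=> /(_ tt) dF.
    rewrite -subr_ge0; apply: (is_derive1_left_max dF t00) => r rt0; rewrite !fctE /GRing.scale/= weq subrr subr_le0.
    by apply/ltW/before => //; lra.
  - rewrite lapE; apply: le_trans (_ : s t0 * \sum_i m i <= _); last first.
      by rewrite ler_wpM2l// ltW.
    rewrite mulr_sumr; apply: ler_sum => i _; rewrite -subr_le0.
    have [Q CQ [Q0 QS]] := Hm i.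
    have [dl dl0 Hdl] := open_line (ebasis i) oO Ox0.
    have CD := C2at0D (Hl i) (C2at0N (C2at0Z (s t0) CQ)).
    apply: (C2at0_local_max CD dl0) => r rdl /=.
    rewrite scale0r addr0 weq Q0 [s t0 * S x0]mulrC subrr subr_le0.
    apply: le_trans (at_t0 _ _) _; first exact/subset_closure/Hdl.
    by rewrite mulrC ler_wpM2l// ltW.
have [Q [c [c0 dQ Q0 QS]]] := S_incr cx0 nOx0.
have [d1 d10 H1] := N_inward cx0 nOx0.
have c20 : 0 < c / 2 by lra.
have [d2 d20 H2] := is_derive1_slope dQ c20.
have [d3 d30 H3] := reg_neumann wP cx0 nOx0 t00 (mulr_gt0 st0 c20).
pose h := Num.min (Num.min d1 d2) d3 / 2.
have m0 : 0 < Num.min (Num.min d1 d2) d3 by rewrite !lt_min d10 d20.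
have m1 : Num.min (Num.min d1 d2) d3 <= d1 by rewrite !ge_min lexx.
have m2 : Num.min (Num.min d1 d2) d3 <= d2 by rewrite !ge_min lexx !orbT.
have m3 : Num.min (Num.min d1 d2) d3 <= d3 by rewrite !ge_min lexx !orbT.
have h0 : 0 < h by rewrite /h; lra.
have hd : [/\ h < d1, h < d2 & h < d3] by rewrite /h; split; lra.
have [hd1 hd2 hd3] := hd.
have hp : 0 < h < d1 /\ 0 < h < d3 by rewrite h0 hd1 hd3.
have Oh := H1 _ hp.1; have := H3 _ hp.2; rewrite ltr_norml => /andP[_].
have := H2 h; rewrite gtr0_norm// => /(_ hd2 (lt0r_neq0 h0)).
rewrite add0r ltr_norml => /andP[_]; rewrite mulrC ltrBlDr ltr_pdivrMr// => Qh.
rewrite mulrC ltr_pdivrMr//.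
have : w (x0 - h *: N x0) t0 <= s t0 * Q h.
  apply: le_trans (at_t0 _ _) _; first exact: subset_closure.
  by rewrite mulrC ler_wpM2l// ltW.
rewrite weq -Q0.
have := mulr_gt0 st0 h0.
have : s t0 * (Q h - Q 0) < s t0 * ((c / 2 - c) * h) by rewrite ltr_pM2l.
nra.
Qed.

End comparison_principle.

Section row_vectors.
Context {R : realType} {n : nat}.
Notation V := 'rV[R]_n.
Implicit Types x y v : V.

Lemma row_norm_le x (c : R) : 0 <= c -> (forall i, `|x 0 i| <= c) -> `|x| <= c.
Proof.
move=> c0 H; rewrite /Num.norm/= mx_normrE; apply: bigmax_le => // -[i j] _ /=.
by rewrite (ord1 i).
Qed.

Lemma row_norm_ge x i : `|x 0 i| <= `|x|.
Proof.
by rewrite {2}/Num.norm/= mx_normrE; exact: (le_bigmax _ (fun ij => `|x ij.1 ij.2|) (0, i)).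
Qed.

Definition dot x y : R := \sum_i x 0 i * y 0 i.

Lemma dotC x y : dot x y = dot y x.
Proof. by apply: eq_bigr => i _; rewrite mulrC. Qed.

Lemma dotDl x y v : dot (x + y) v = dot x v + dot y v.
Proof. by rewrite -big_split; apply: eq_bigr => i _; rewrite !mxE mulrDl. Qed.

Lemma dotZl (a : R) x v : dot (a *: x) v = a * dot x v.
Proof. by rewrite mulr_sumr; apply: eq_bigr => i _; rewrite !mxE mulrA. Qed.

Lemma dotNl x v : dot (- x) v = - dot x v.
Proof. by rewrite -scaleN1r dotZl mulN1r. Qed.

Lemma dotDr x y v : dot v (x + y) = dot v x + dot v y.
Proof. by rewrite !(dotC v) dotDl. Qed.

Lemma dotZr (a : R) x v : dot v (a *: x) = a * dot v x.
Proof. by rewrite !(dotC v) dotZl. Qed.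

Lemma dotNr x v : dot v (- x) = - dot v x.
Proof. by rewrite !(dotC v) dotNl. Qed.

Lemma dot_ebasis x i : dot x (ebasis i) = x 0 i.
Proof.
rewrite /dot (bigD1 i)//= big1 ?addr0 /ebasis ?mxE ?eqxx ?mulr1// => j ji.
by rewrite mxE (negbTE ji) andbF mulr0.
Qed.

Lemma dot_ge0 x : 0 <= dot x x.
Proof. by apply: sumr_ge0 => i _; rewrite -expr2 sqr_ge0. Qed.

Lemma le_coord_dot x i : x 0 i ^+ 2 <= dot x x.
Proof.
rewrite /dot (bigD1 i)//= -expr2 lerDl; apply: sumr_ge0 => j _.
by rewrite -expr2 sqr_ge0.
Qed.

Lemma dot_gt0 x : x != 0 -> 0 < dot x x.
Proof.
move=> x0; rewrite lt_neqAle dot_ge0 andbT; apply: contra_neq x0 => xx0.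
apply/rowP => i; rewrite mxE; apply/eqP; rewrite -sqrf_eq0 eq_le sqr_ge0 andbT.
by rewrite xx0 le_coord_dot.
Qed.

Lemma norm_dot_le x y : `|dot x y| <= n%:R * `|x| * `|y|.
Proof.
rewrite /dot; apply: le_trans (ler_norm_sum _ _ _) _.
apply: le_trans (_ : \sum_(i < n) `|x| * `|y| <= _).
  by apply: ler_sum => i _; rewrite normrM ler_pM// row_norm_ge.
by rewrite sumr_const card_ord -mulrA mulr_natl.
Qed.

Lemma dot_quad x y (r : R) :
  dot (x + r *: y) (x + r *: y) = dot x x + 2 * r * dot x y + r ^+ 2 * dot y y.
Proof. rewrite !dotDl !dotDr !dotZl !dotZr (dotC y x); ring. Qed.

Lemma sqr_norm_le_dot x : `|x| ^+ 2 <= dot x x.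
Proof.
have : `|x| <= Num.sqrt (dot x x).
  apply: row_norm_le => [|i]; first exact: sqrtr_ge0.
  by rewrite -sqrtr_sqr ler_sqrt ?dot_ge0// le_coord_dot.
by move=> H; rewrite -[leRHS]sqr_sqrtr ?dot_ge0// lerXn2r// nnegrE ?sqrtr_ge0.
Qed.

Lemma derivable_line (f : V -> R) x v (r : R) : derivable f (x + r *: v) v ->
  is_derive r 1 (fun r => f (x + r *: v)) ('D_v f (x + r *: v)).
Proof.
move=> df.
have E : (fun h : R => h^-1 *: (((fun r => f (x + r *: v)) \o shift r) (h *: 1)
      - f (x + r *: v))) =
    (fun h : R => h^-1 *: ((f \o shift (x + r *: v)) (h *: v) - f (x + r *: v))).
  apply/funext => h /=; congr (_ *: (f _ - _)).
  by rewrite [h *: 1]mulr1 scalerDl addrCA.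
by split; rewrite /derivable /derive E.
Qed.

End row_vectors.

Section C21.
Context {R : realType} {n : nat}.
Notation V := 'rV[R]_n.
Implicit Types (Omega : set V) (phi : V -> R).

Lemma defining_continuous Omega phi : defining_function Omega phi -> continuous phi.
Proof. by move=> [d _] x; apply: differentiable_continuous; exact: d. Qed.

Lemma defining_closure Omega phi x : defining_function Omega phi ->
  closure Omega x -> phi x <= 0.
Proof.
move=> dphi; have [_ [_ [-> _]]] := dphi.
have : closed [set x | phi x <= 0].
  rewrite (_ : [set x | _] = phi @^-1` [set y | y <= 0])//.
  by apply: closed_comp => [y _|]; [exact: (defining_continuous dphi)|exact: closed_le].
move=> c cx; suff : closure [set x | phi x <= 0] x by rewrite -((closure_id _).1 c).
by apply: closure_subset cx => y /=; exact: ltW.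
Qed.

Lemma defining_lt0 Omega phi x : defining_function Omega phi -> phi x < 0 -> Omega x.
Proof. by move=> [_ [_ [-> _]]]. Qed.

Lemma defining_boundary Omega phi x : defining_function Omega phi ->
  closure Omega x -> ~ Omega x -> phi x = 0.
Proof.
move=> dphi cx nx; apply/eqP; rewrite eq_le (defining_closure dphi)//=.
have [_ [_ [OE _]]] := dphi; rewrite leNgt; apply/negP => px; apply: nx.
by rewrite OE.
Qed.

Lemma defining_line Omega phi x (v : V) (r : R) : defining_function Omega phi ->
  is_derive r 1 (fun r => phi (x + r *: v)) (dot (gradient phi (x + r *: v)) v).
Proof.
move=> [d _]; have := @derivable_line _ _ phi x v r.
have dphi := d (x + r *: v).
have dv : derivable phi (x + r *: v) v by exact: diff_derivable.
suff E : 'D_v phi (x + r *: v) = dot (gradient phi (x + r *: v)) v.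
  by move=> /(_ dv); rewrite E.
move: (x + r *: v) dphi => y dy; rewrite deriveE//.
have -> : 'd phi y v = 'd phi y (\sum_j v 0 j *: delta_mx 0 j) by rewrite -row_sum_delta.
rewrite linear_sum; apply: eq_bigr => i _.
by rewrite linearZ/= mxE /pder deriveE// mulrC.
Qed.

Lemma C21_regular Omega phi w : open Omega -> defining_function Omega phi ->
  C21_sol Omega w ->
  regular Omega (gradient phi) w (fun x t => derive1 (w x) t)
    (fun x t => laplacian (w ^~ t) x).
Proof.
move=> oO dphi [cw [dw [_ [_ nw]]]]; split=> //.
- move=> x t Ox t0; have [d _] := dw x t Ox t0.
  by split => //; rewrite derive1E.
- move=> x t Ox t0.
  exists (fun i => pder i (pder i (w ^~ t)) x); split=> // i.
  exists (fun r => pder i (w ^~ t) (x + r *: ebasis i)); split.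
    have [dl dl0 H] := open_line (ebasis i) oO Ox.
    exists dl => // r /H Oxr; have [_ [d _]] := dw _ _ Oxr t0.
    exact: (derivable_line (d i)).
  have [_ [_ d]] := dw _ _ Ox t0.
  have := @derivable_line _ _ (pder i (w ^~ t)) x (ebasis i) 0.
  by rewrite scale0r addr0 => /(_ (d i)).
- move=> x t cx nx t0 e e0.
  have := nw t t0 x (conj cx nx) phi dphi (defining_boundary dphi cx nx).
  move=> /cvgrPdist_lt/(_ e e0); rewrite near_withinE => /nbhs_ballP[dl /= dl0 H].
  exists dl => // h /andP[h0 hd]; have := H h.
  rewrite -ball_normE /ball_ /= sub0r normrN gtr0_norm// => /(_ hd h0).
  by rewrite sub0r normrN.
Qed.

End C21.

Section quadratics.
Context {R : realType}.

Lemma is_derive_quad (a b c r : R) :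
  is_derive r 1 (fun r => a + b * r + c * r ^+ 2) (b + 2 * c * r).
Proof.
have did : is_derive r 1 (@id R) 1 by exact: is_derive_id.
have d1 := is_deriveZ b did.
have d2 := is_deriveZ c (is_deriveX 2 did).
have := is_deriveD (is_deriveD (is_derive_cst a r 1) d1) d2.
rewrite /GRing.scale/= => -[H1 H2]; split; first by [].
by rewrite H2 /= expr1 /GRing.scale/=; ring.
Qed.

Lemma C2at0_quad (a b c : R) : C2at0 (fun r => a + b * r + c * r ^+ 2) (2 * c).
Proof.
exists (fun r => b + 2 * c * r); split.
  by exists 1 => // r _; exact: is_derive_quad.
have := is_derive_quad b (2 * c) 0 0.
rewrite mulr0 addr0; congr is_derive.
by apply/funext => r; rewrite mul0r addr0.
Qed.

End quadratics.

Lemma continuous_bigsum {R : realType} (T : topologicalType) (I : Type) (s : seq I)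
  (F : I -> T -> R) : (forall i, continuous (F i)) ->
  continuous (fun x => \sum_(i <- s) F i x).
Proof.
move=> cF; elim: s => [|i s IH] x.
  by under eq_fun do rewrite big_nil; exact: cvg_cst.
by under eq_fun do rewrite big_cons; apply: cvgD; [exact: cF|exact: IH].
Qed.

Section compactness.
Context {R : realType} {n : nat}.
Notation V := 'rV[R]_n.

Lemma compact_uniform_continuity (A : set V) (f : V -> R) : compact A ->
  {within A, continuous f} -> forall e, 0 < e -> exists2 dl : R, 0 < dl &
    forall x y, A x -> A y -> `|x - y| < dl -> `|f x - f y| < e.
Proof.
move=> cA cf e e0.
have cg : {within A `*` A, continuous (fun p : V * V => e - `|f p.1 - f p.2|)}.
  apply/within_continuous_ballP => -[x y] [/= Ax Ay] d d0.
  have d20 : 0 < d / 2 by lra.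
  have [d1 d10 H1] := (within_continuous_ballP _ _).1 cf x Ax _ d20.
  have [d2 d20' H2] := (within_continuous_ballP _ _).1 cf y Ay _ d20.
  exists (Num.min d1 d2); first by rewrite lt_min d10.
  move=> [x' y'] [/= Ax' Ay'] [/= xx' yy'].
  have := H1 x' Ax' (le_ball _ xx'); rewrite ge_min lexx => /(_ isT) h1.
  have := H2 y' Ay' (le_ball _ yy'); rewrite ge_min lexx orbT => /(_ isT) h2.
  rewrite opprB addrC addrA subrK.
  apply: le_lt_trans (ler_dist_dist _ _) _.
  rewrite (_ : _ - _ = (f y - f y') - (f x - f x')); last by ring.
  by apply: le_lt_trans (ler_normB _ _) _; lra.
have cZ := compact_within_le0 (compact_setX cA cA) cg.
have [[p Zp]|nZ] := pselect ((A `*` A `&` [set p | e - `|f p.1 - f p.2| <= 0]) !=set0);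
  last first.
  exists 1 => // x y Ax Ay _; rewrite ltNge; apply/negP => exy; apply: nZ.
  by exists (x, y); split => //=; rewrite subr_le0.
have [||[x0 y0]] := @compact_EVT_min _ _ (fun p : V * V => `|p.1 - p.2|) _ _ cZ.
- by exists p.
- apply: continuous_subspaceT => q; apply: cvg_norm.
  by apply: cvgB; [exact: cvg_fst|exact: cvg_snd].
rewrite inE => -[[/= Ax0 Ay0]]; rewrite subr_le0 => fe min0.
exists `|x0 - y0|.
  rewrite normr_gt0; apply/eqP => /subr0_eq xy0.
  by move: fe; rewrite xy0 subrr normr0; lra.
move=> x y Ax Ay xy; rewrite ltNge; apply/negP => fxy.
suff : `|x0 - y0| <= `|x - y| by rewrite leNgt xy.
by apply: (min0 (x, y)); rewrite inE; split => //=; rewrite subr_le0.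
Qed.

Lemma compact_bounded_fun (A : set V) (f : V -> R) : compact A ->
  {within A, continuous f} -> exists2 M : R, 0 < M & forall x, A x -> `|f x| <= M.
Proof.
move=> cA cf; have [[a Aa]|nA] := pselect (A !=set0); last first.
  by exists 1 => // x Ax; exfalso; apply: nA; exists x.
have [|c _ cmax] := EVT_max_rV _ cA cf; first by exists a.
have [|d _ dmin] := EVT_min_rV _ cA cf; first by exists a.
exists (`|f c| + `|f d| + 1); first by rewrite ltr_wpDl// addr_ge0.
move=> x Ax; rewrite -inE in Ax; have := cmax x Ax; have := dmin x Ax.
have := ler_norm (f c); have := ler_norm (- f d); rewrite normrN.
have := normr_ge0 (f c); have := normr_ge0 (f d).
by rewrite ler_norml; lra.
Qed.

Lemma closed_norm_le (M : R) : closed [set x : V | `|x| <= M].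
Proof.
rewrite (_ : [set x | _] = (fun x : V => `|x|) @^-1` [set y | y <= M])//.
by apply: closed_comp => [y _|]; [exact: norm_continuous|exact: closed_le].
Qed.

Lemma compact_norm_le (M : R) : compact [set x : V | `|x| <= M].
Proof.
apply: bounded_closed_compact; last exact: closed_norm_le.
exists M; split; first exact: num_real.
by move=> e Me x /= xM; exact: le_trans xM (ltW Me).
Qed.

Lemma bounded_closure (Omega : set V) : bounded_set Omega ->
  exists2 M : R, 0 < M & forall x, closure Omega x -> `|x| <= M.
Proof.
move=> [M [_ H]]; exists (`|M| + 1); first by rewrite ltr_wpDl.
move=> x cx; suff : closure [set x : V | `|x| <= `|M| + 1] x.
  by rewrite -((closure_id _).1 (@closed_norm_le _)).
apply: closure_subset cx => y Oy /=; apply: H => //.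
by rewrite (le_lt_trans (ler_norm M))// ltrDl.
Qed.

End compactness.

Section domain_geometry.
Context {R : realType} {n : nat}.
Notation V := 'rV[R]_n.
Variables (Omega : set V) (phi : V -> R) (M : R).
Hypotheses (O0 : Omega !=set0) (dphi : defining_function Omega phi).
Hypotheses (M0 : 0 < M) (OM : forall x, closure Omega x -> `|x| <= M).

Let BB := [set x : V | `|x| <= M + 1].

Lemma compact_closure_domain : compact (closure Omega).
Proof.
apply: bounded_closed_compact; last exact: closed_closure.
exists M; split; first exact: num_real.
by move=> e Me x /OM xM; exact: le_trans xM (ltW Me).
Qed.

Lemma inward_domain x : closure Omega x -> ~ Omega x ->
  exists2 dl : R, 0 < dl & forall h, 0 < h < dl -> Omega (x - h *: gradient phi x).
Proof.
move=> cx nx; have px := defining_boundary dphi cx nx.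
have [_ [_ [OE pn0]]] := dphi; have p0 := dot_gt0 (pn0 x px).
have := defining_line x (- gradient phi x) 0 dphi.
rewrite scale0r addr0 dotNr => /is_derive1_slope/(_ _ p0)[dl dl0 H].
exists dl => // h /andP[h0 hd]; have := H h.
rewrite gtr0_norm// => /(_ hd (lt0r_neq0 h0)); rewrite add0r scale0r addr0 px subr0.
rewrite ltr_norml opprK => /andP[_]; rewrite -ltrBrDr subrr pmulr_rlt0 ?invr_gt0//.
by rewrite OE /= scalerN.
Qed.

Lemma gradient_coord_continuous i : continuous (fun x : V => gradient phi x 0 i).
Proof.
have [_ [c _]] := dphi; rewrite (_ : (fun x => _) = pder i phi)//.
by apply/funext => x; rewrite mxE.
Qed.

Lemma gradient_bounded : exists2 G : R, 0 < G & forall x, `|x| <= M + 1 -> `|gradient phi x| <= G.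
Proof.
have H i : exists g, 0 < g /\ forall x, BB x -> `|gradient phi x 0 i| <= g.
  have [g g0 Hg] := compact_bounded_fun (@compact_norm_le R n (M + 1))
    (continuous_subspaceT (@gradient_coord_continuous i)).
  by exists g.
have [g Hg] := choice H.
exists (1 + \sum_i g i).
  by rewrite ltr_wpDr// sumr_ge0// => i _; rewrite ltW// (Hg i).1.
move=> x xB; apply: row_norm_le => [|i].
  by rewrite addr_ge0// sumr_ge0// => i _; rewrite ltW// (Hg i).1.
apply: le_trans ((Hg i).2 x xB) _; rewrite (bigD1 i)//= addrCA lerDl addr_ge0//.
by apply: sumr_ge0 => j _; rewrite ltW// (Hg j).1.
Qed.

Lemma gradient_uniform e : 0 < e -> exists2 dl : R, 0 < dl & forall x y,
  `|x| <= M + 1 -> `|y| <= M + 1 -> `|x - y| < dl ->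
  `|gradient phi x - gradient phi y| <= e.
Proof.
move=> e0.
have H i : exists d, 0 < d /\ forall x y, BB x -> BB y -> `|x - y| < d ->
    `|gradient phi x 0 i - gradient phi y 0 i| < e.
  have [g g0 Hg] := compact_uniform_continuity (@compact_norm_le R n (M + 1))
    (continuous_subspaceT (@gradient_coord_continuous i)) e0.
  by exists g.
have [d Hd] := choice H.
exists (\big[Num.min/1]_i d i).
  by apply: lt_bigmin => // i _; exact: (Hd i).1.
move=> x y xB yB xy; apply: row_norm_le => [|i]; first exact: ltW.
rewrite !mxE; apply: ltW; have := (Hd i).2 x y xB yB; rewrite !mxE; apply.
by apply: lt_le_trans xy _; exact: bigmin_le.
Qed.

Lemma gradient_or_depth : exists2 g : R, 0 < g & forall x, closure Omega x ->
  g <= dot (gradient phi x) (gradient phi x) \/ phi x <= - g.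
Proof.
pose F x := dot (gradient phi x) (gradient phi x) - phi x.
have cd : continuous (fun y => dot (gradient phi y) (gradient phi y)).
  have := @continuous_bigsum R V 'I_n (index_enum _)
    (fun i y => gradient phi y 0 i * gradient phi y 0 i).
  by apply => i y; have h := @gradient_coord_continuous i y; exact: (cvgM h h).
have cF : continuous F.
  by move=> x; exact: (cvgB (cd x) (defining_continuous dphi (x := x))).
have [|c] := @compact_EVT_min _ _ F _ _ compact_closure_domain (continuous_subspaceT cF).
  by have [x Ox] := O0; exists x; exact: subset_closure.
rewrite inE => cc cmin.
have Fc : 0 < F c.
  have := defining_closure dphi cc; rewrite le_eqVlt => /orP[/eqP pc|pc].
    by rewrite /F pc subr0; apply: dot_gt0; have [_ [_ [_ ]]] := dphi; apply.
  by rewrite /F; have := dot_ge0 (gradient phi c); lra.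
exists (F c / 2); first by lra.
move=> x cx; have := cmin x; rewrite inE => /(_ cx) Fx.
have [h|h] := leP (F c / 2) (dot (gradient phi x) (gradient phi x)); first by left.
by right; move: Fx h; rewrite {2}/F; lra.
Qed.

Lemma defining_mvt (x v : V) : exists2 th : R, 0 <= th <= 1 &
  phi (x + v) - phi x = dot (gradient phi (x + th *: v)) v.
Proof.
have dF (r : R) : is_derive r 1 (fun r => phi (x + r *: v)) (dot (gradient phi (x + r *: v)) v).
  exact: (defining_line _ _ _ dphi).
have [|c] := MVT_segment (ler01 : (0 : R) <= 1) (fun r _ => dF r).
  exact: (is_derive1_within_continuous (fun r _ => dF r)).
by rewrite in_itv/= => c01 /=; rewrite scale1r scale0r addr0 subr0 mulr1; exists c.
Qed.

Lemma inner_ball : exists C0 h0 : R, [/\ 0 < C0, 0 < h0 &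
  forall x h, closure Omega x -> 0 < h < h0 -> exists2 z, `|z - x| <= C0 * h &
    forall y, `|y - z| <= h -> Omega y].
Proof.
have [g g0 Hg] := gradient_or_depth.
have [G G0 HG] := gradient_bounded.
pose nn : R := n%:R; have nn0 : 0 <= nn by exact: ler0n.
pose nG : R := nn * G; have nG0 : 0 <= nG by rewrite mulr_ge0// ltW.
pose eta : R := g / (2 * (nG + 1)).
have eta0 : 0 < eta by rewrite divr_gt0// mulr_gt0//; lra.
have etaE : eta * (nG + 1) = g / 2.
  by rewrite /eta; field; lra.
have [d1 d10 H1] := gradient_uniform eta0.
have [d2 d20 H2] := compact_uniform_continuity (@compact_norm_le R n (M + 1))
    (continuous_subspaceT (defining_continuous dphi)) g0.
pose S : R := 2 / g * (nG + nn * eta + 1).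
have S0 : 0 < S.
  have ne0 : 0 <= nn * eta by rewrite mulr_ge0// ltW.
  by apply: mulr_gt0; [rewrite divr_gt0|lra].
pose C : R := S * G + 1.
have C0 : 1 < C by rewrite ltrDr mulr_gt0.
exists C, (Num.min 1 (Num.min d1 d2) / C); split; first by lra.
  by rewrite divr_gt0 ?lt_min ?ltr01 ?d10//; lra.
move=> x h cx /andP[h0]; rewrite ltr_pdivlMr; last by lra.
rewrite !lt_min => /and3P[hC1 hCd1 hCd2].
have hhC : h < h * C by rewrite ltr_pMr.
have xM := OM cx.
have px := defining_closure dphi cx.
have [gx|gx] := Hg x cx; last first.
  exists x; first by rewrite subrr normr0 mulr_ge0//; lra.
  move=> y yx; apply: (defining_lt0 dphi).
  have yM : `|y| <= M + 1.
    by rewrite -(subrK x y); apply: le_trans (ler_normD _ _) _; lra.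
  have := H2 y x yM; rewrite ltr_norml /=.
  have xM1 : `|x| <= M + 1 by lra.
  have yxd : `|y - x| < d2 by lra.
  by move=> /(_ xM1 yxd); lra.
have Sh0 : 0 < S * h by exact: mulr_gt0.
have Sh0' := ltW Sh0.
exists (x - (S * h) *: gradient phi x).
  rewrite addrAC subrr add0r normrN normrZ gtr0_norm//.
  apply: le_trans (_ : S * h * G <= _).
    by apply: ler_wpM2l => //; apply: HG; lra.
  by rewrite /C mulrDl mul1r -mulrA [h * G]mulrC mulrA lerDl ltW.
move=> y; set e := y - _ => eh; apply: (defining_lt0 dphi).
pose v := - (S * h) *: gradient phi x + e.
have yE : y = x + v by rewrite /v /e scaleNr; apply/rowP => i; rewrite !mxE; ring.
have vle : `|v| <= h * C.
  rewrite /v scaleNr; apply: le_trans (ler_normD _ _) _.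
  rewrite normrN normrZ gtr0_norm//.
  have : S * h * `|gradient phi x| <= S * h * G.
    by apply: ler_wpM2l => //; apply: HG; lra.
  by rewrite /C; lra.
have [th th01 mvt] := defining_mvt x v.
have thv : `|th *: v| <= h * C.
  rewrite normrZ ger0_norm; last by lra.
  by apply: le_trans vle; rewrite ler_piMl//; lra.
set q := gradient phi (x + th *: v) in mvt.
have qp : `|q - gradient phi x| <= eta.
  apply: H1; rewrite ?[x + _]addrC ?addrK; [|lra|lra].
  by apply: le_trans (ler_normD _ _) _; lra.
have hp : dot (gradient phi x) e <= nG * h.
  apply: le_trans (ler_norm _) _; apply: le_trans (norm_dot_le _ _) _.
  apply: ler_pM => //; rewrite ?mulr_ge0// /nG ler_wpM2l//.
  by apply: HG; lra.
have hq : dot (q - gradient phi x) v <= nn * eta * (h * C).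
  apply: le_trans (ler_norm _) _; apply: le_trans (norm_dot_le _ _) _.
  by apply: ler_pM => //; rewrite ?mulr_ge0// /nG ler_wpM2l.
have qE : dot q v = - (S * h) * dot (gradient phi x) (gradient phi x)
    + dot (gradient phi x) e + dot (q - gradient phi x) v.
  have -> : dot q v = dot (q - gradient phi x) v + dot (gradient phi x) v.
    by rewrite -dotDl subrK.
  have -> : dot (gradient phi x) v =
      - (S * h) * dot (gradient phi x) (gradient phi x) + dot (gradient phi x) e.
    by rewrite dotDr dotZr.
  by rewrite addrC.
have : S * h * g <= S * h * dot (gradient phi x) (gradient phi x).
  by rewrite ler_wpM2l.
have k1 : S * g = 2 * (nG + nn * eta + 1) by rewrite /S; field; lra.
have k2 : nn * eta * C * h = nn * eta * h + (eta * nG) * S * h by rewrite /C /nG; ring.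
have k3 : eta * nG * S * h <= g / 2 * S * h.
  rewrite !ler_wpM2r ?(ltW h0) ?(ltW S0)//; lra.
have k4 : S * h * g = S * g * h by ring.
rewrite k4 k1.
have k5 : g / 2 * S * h = (nG + nn * eta + 1) * h.
  by rewrite (_ : g / 2 * S = S * g / 2) ?k1; lra.
rewrite yE; move: mvt hp hq; rewrite qE; lra.
Qed.

End domain_geometry.

Section boundary_barrier.
Context {R : realType} {n : nat}.
Notation V := 'rV[R]_n.
Variables (Omega : set V) (phi : V -> R) (M : R).
Hypotheses (O0 : Omega !=set0) (dphi : defining_function Omega phi).
Hypotheses (M0 : 0 < M) (OM : forall x, closure Omega x -> `|x| <= M).

Let BB := [set x : V | `|x| <= M + 1].

Lemma continuous_sqdist (x : V) : continuous (fun z : V => dot (x - z) (x - z)).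
Proof.
have := @continuous_bigsum R V 'I_n (index_enum _) (fun i z => (x - z) 0 i * (x - z) 0 i).
apply => i z.
have h : (fun z : V => (x - z) 0 i) @ z --> (x - z) 0 i.
  rewrite (_ : (fun _ => _) = (fun z : V => x 0 i - z 0 i)); last first.
    by apply/funext => y; rewrite !mxE.
  by rewrite !mxE; exact: (cvgB (cvg_cst _) (@coord_continuous _ _ _ 0 i z)).
exact: (cvgM h h).
Qed.

Lemma inf_convolution_attained (K : R) (x : V) : exists y, `|y| <= M + 1 /\
  forall z, `|z| <= M + 1 ->
    phi y + K * dot (x - y) (x - y) <= phi z + K * dot (x - z) (x - z).
Proof.
pose F z := phi z + K * dot (x - z) (x - z).
have cF : continuous F.
  move=> z; exact: (cvgD (defining_continuous dphi (x := z))
    (cvgM (cvg_cst K) (@continuous_sqdist x z))).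
have [|y] := @compact_EVT_min _ _ F _ _ (@compact_norm_le R n (M + 1))
  (continuous_subspaceT cF).
  by exists 0; rewrite /= normr0 addr_ge0// ltW.
by rewrite inE => yB ymin; exists y; split=> // z zB; apply: ymin; rewrite inE.
Qed.

(* The infimal convolution of [phi] with a steep paraboloid: it is touched from
   above by the paraboloid centred at the minimiser [y], whose gradient at [x] is
   the gradient of [phi] at [y], hence nearly outward. *)
Lemma boundary_barrier : exists (zeta : V -> R) (Z K g : R),
  [/\ [/\ 0 < Z, 0 < K & 0 < g], {within closure Omega, continuous zeta},
      forall x, closure Omega x -> `|zeta x| <= Z,
      forall x, closure Omega x -> touched_above zeta x K &
      forall x, closure Omega x -> ~ Omega x -> exists (Q : R -> R) (c : R),
        [/\ g <= c, is_derive (0 : R) 1 Q (- c), Q 0 = zeta x &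
            forall r, zeta (x - r *: gradient phi x) <= Q r]].
Proof.
have M0' := M0.
have [g g0 Hg] := gradient_or_depth O0 dphi OM.
have [G G0 HG] := gradient_bounded M dphi.
have [P P0 HP] := compact_bounded_fun (@compact_norm_le R n (M + 1))
    (continuous_subspaceT (defining_continuous dphi)).
pose nn : R := n%:R; have nn0 : 0 <= nn by exact: ler0n.
have nG0 : 0 <= nn * G by rewrite mulr_ge0// ltW.
pose eta : R := g / (2 * (nn * G + 1)).
have eta0 : 0 < eta by rewrite divr_gt0// mulr_gt0//; lra.
have etaE : eta * (nn * G + 1) = g / 2 by rewrite /eta; field; lra.
have [dl dl0 Hdl] := gradient_uniform M dphi eta0.
pose rho : R := Num.min 1 dl / 2.
have m1 : Num.min 1 dl <= 1 by rewrite ge_min lexx.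
have m2 : Num.min 1 dl <= dl by rewrite ge_min lexx orbT.
have m0 : 0 < Num.min 1 dl by rewrite lt_min ltr01.
have [rho0 rho1 rhod] : [/\ 0 < rho, rho < 1 & rho < dl] by rewrite /rho; split; lra.
have r20 : 0 < rho ^+ 2 by rewrite exprn_gt0.
pose K : R := 2 * P / rho ^+ 2.
have K0 : 0 < K by rewrite /K divr_gt0// mulr_gt0.
have KE : K * rho ^+ 2 = 2 * P by rewrite /K divfK// gt_eqF.
clearbody K.
have [ys Hys] := choice (inf_convolution_attained K).
pose q (y x : V) : R := phi y + K * dot (x - y) (x - y).
pose zeta (x : V) : R := q (ys x) x.
have zle x y : `|y| <= M + 1 -> zeta x <= q y x by exact: (Hys x).2.
have M1 (x : V) : closure Omega x -> `|x| <= M + 1 by move=> /OM; lra.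
have near_ys (x : V) : closure Omega x -> `|x - ys x| <= rho.
  move=> cx; have := zle x x (M1 _ cx).
  rewrite /zeta /q subrr (_ : dot 0 0 = 0); last first.
    by rewrite /dot big1// => i _; rewrite mxE mul0r.
  rewrite mulr0 addr0 => h.
  have := HP x (M1 _ cx); have := HP (ys x) (Hys x).1; rewrite !ler_norml => b1 b2.
  have Kd : K * dot (x - ys x) (x - ys x) <= K * rho ^+ 2 by rewrite KE; lra.
  move: Kd; rewrite ler_pM2l// => /(le_trans (sqr_norm_le_dot _)).
  by rewrite ler_pXn2r// nnegrE// ltW.
have stat x : closure Omega x -> gradient phi (ys x) = (2 * K) *: (x - ys x).
  move=> cx; set y := ys x; set v := gradient phi y - (2 * K) *: (x - y).
  suff : dot v v <= 0.
    move=> vv; apply/eqP; rewrite -subr_eq0; apply/negPn/negP => /dot_gt0.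
    by rewrite ltNge vv.
  have yM : `|y| < M + 1.
    have := ler_normB x (x - y); rewrite opprB addrC subrK.
    by have := near_ys x cx; have := OM cx; rewrite -/y; lra.
  have [d d0 Hd] : exists2 d : R, 0 < d & forall r, `|r| < d -> `|y + r *: v| <= M + 1.
    have v0 : 0 < `|v| + 1 by rewrite ltr_wpDl.
    exists ((M + 1 - `|y|) / (`|v| + 1)); first by rewrite divr_gt0//; lra.
    move=> r; rewrite ltr_pdivlMr// => rv; apply: le_trans (ler_normD _ _) _.
    rewrite normrZ; have : `|r| * `|v| <= `|r| * (`|v| + 1) by rewrite ler_wpM2l//; lra.
    lra.
  have d1 := defining_line y v 0 dphi; rewrite scale0r addr0 in d1.
  have d2 := is_derive_quad (K * dot (x - y) (x - y))
    (- (2 * K * dot (x - y) v)) (K * dot v v) 0.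
  have dF := is_deriveN (is_deriveD d1 d2).
  have qE r : q (y + r *: v) x = phi (y + r *: v) +
      (K * dot (x - y) (x - y) + - (2 * K * dot (x - y) v) * r + K * dot v v * r ^+ 2).
    rewrite /q opprD addrA -scaleNr dot_quad; ring.
  have dE : dot v v = dot (gradient phi y) v - 2 * K * dot (x - y) v.
    by rewrite {1}/v dotDl dotNl dotZl.
  have Nd0 : - d < 0 by lra.
  have := is_derive1_left_max dF Nd0; rewrite mulr0 addr0 -dE oppr_ge0; apply.
  move=> r rd; rewrite !fctE lerN2 -!qE scale0r addr0; apply: (zle x); apply: Hd.
  by rewrite ltr_norml; lra.
have qline (y x v : V) (r : R) : q y (x + r *: v) =
    q y x + 2 * K * dot (x - y) v * r + K * dot v v * r ^+ 2.
  by rewrite /q addrAC dot_quad; ring.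
have norm_sub (x y : V) : `|x| <= M + 1 -> `|y| <= M + 1 -> `|x - y| <= 2 * (M + 1).
  move=> hx hy; apply: le_trans (ler_normB _ _) _.
  by rewrite mulr_natl mulr2n; exact: lerD.
pose D : R := 2 * (M + 1); have D0 : 0 < D by rewrite mulr_gt0// addr_gt0.
have DE : D = 2 * (M + 1) by []; clearbody D.
have K0' := ltW K0; have D0' := ltW D0; have nD0 := mulr_ge0 nn0 D0'.
have KD0 := mulr_ge0 K0' (mulr_ge0 nD0 D0').
exists zeta, (P + K * (nn * D * D)), (nn * (2 * K) + 1), (g / 2); split.
- split; [|have := mulr_ge0 nn0 (ltW K0); lra|lra].
  by rewrite ltr_wpDr.
- have half x x' : closure Omega x -> closure Omega x' ->
      zeta x' - zeta x <= K * (nn * (2 * D)) * `|x - x'|.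
    move=> cx cx'.
    apply: le_trans (_ : q (ys x) x' - q (ys x) x <= _).
      by rewrite lerD2r; apply: zle; exact: (Hys x).1.
    rewrite (_ : _ - _ = K * (2 * dot (x - ys x) (x' - x) + dot (x' - x) (x' - x)));
      last first.
      have -> : x' = x + 1 *: (x' - x) by rewrite scale1r addrC subrK.
      rewrite qline [_ + 1 *: _ - x]addrC addKr scale1r; ring.
    rewrite -mulrA; apply: ler_wpM2l => //.
    have b1 := le_trans (ler_norm _) (norm_dot_le (x - ys x) (x' - x)).
    have b2 := le_trans (ler_norm _) (norm_dot_le (x' - x) (x' - x)).
    have c1 : n%:R * `|x - ys x| * `|x' - x| <= nn * (D / 2) * `|x' - x|.
      rewrite ler_wpM2r// ler_wpM2l//; have := near_ys x cx; rewrite DE; lra.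
    have c2 : n%:R * `|x' - x| * `|x' - x| <= nn * D * `|x' - x|.
      by rewrite ler_wpM2r// ler_wpM2l// DE; apply: norm_sub; exact: M1.
    rewrite [`|x - x'|]distrC; move: b1 b2 c1 c2; rewrite -/nn; lra.
  pose C : R := K * (nn * (2 * D)) + 1.
  have C0 : 0 < C.
    by rewrite ltr_wpDl//; apply: mulr_ge0 => //; apply: mulr_ge0 => //; lra.
  apply/within_continuous_ballP => x cx e e0; exists (e / C); first by rewrite divr_gt0.
  move=> x' cx'; rewrite -ball_normE /ball_/= ltr_pdivlMr// => xx'.
  have := half x x' cx cx'; have := half x' x cx' cx; rewrite [`|x' - x|]distrC.
  by have := normr_ge0 (x - x'); rewrite ltr_norml /C in xx' *; lra.
- move=> x cx; rewrite /zeta /q; apply: le_trans (ler_normD _ _) _; apply: lerD.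
    by apply: HP; exact: (Hys x).1.
  rewrite normrM (gtr0_norm K0) ler_pM2l//; apply: le_trans (norm_dot_le _ _) _.
  have := norm_sub x (ys x) (M1 _ cx) (Hys x).1; rewrite -/nn -DE => h.
  by apply: ler_pM => //; [rewrite mulr_ge0|rewrite ler_wpM2l].
- move=> x cx; exists (fun=> 2 * K); split.
    by rewrite sumr_const card_ord -mulr_natl; lra.
  move=> i; exists (fun r => q (ys x) x + 2 * K * (x - ys x) 0 i * r + K * r ^+ 2).
    exact: C2at0_quad.
  split; first by rewrite mulr0 expr0n/= mulr0 !addr0.
  move=> r; apply: le_trans (zle _ (ys x) (Hys x).1) _.
  by rewrite qline !dot_ebasis [ebasis i 0 i]mxE !eqxx/= mulr1.
- move=> x cx nx; set p := gradient phi x.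
  exists (fun r => q (ys x) x + - (dot (gradient phi (ys x)) p) * r + K * dot p p * r ^+ 2),
    (dot (gradient phi (ys x)) p); split.
  + have px := defining_boundary dphi cx nx.
    have [gp|gp] := Hg x cx; last by lra.
    have yd : `|ys x - x| < dl by rewrite distrC; have := near_ys x cx; lra.
    have := Hdl _ _ (Hys x).1 (M1 _ cx) yd; rewrite -/p => qp.
    have -> : dot (gradient phi (ys x)) p =
        dot (gradient phi (ys x) - p) p + dot p p by rewrite -dotDl subrK.
    have := norm_dot_le (gradient phi (ys x) - p) p; rewrite ler_norml => /andP[+ _].
    have : n%:R * `|gradient phi (ys x) - p| * `|p| <= nn * eta * G.
      by apply: ler_pM; rewrite ?mulr_ge0 ?ler_wpM2l//; exact: HG (M1 _ cx).
    have : nn * eta * G <= g / 2 by rewrite -etaE; lra.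
    rewrite -/p in gp *; lra.
  + have := is_derive_quad (q (ys x) x) (- dot (gradient phi (ys x)) p) (K * dot p p) 0.
    by rewrite mulr0 addr0.
  + by rewrite mulr0 expr0n/= mulr0 !addr0.
  + move=> r; apply: le_trans (zle _ (ys x) (Hys x).1) _.
    rewrite -scaleNr qline (stat x cx) dotZl le_eqVlt; apply/orP; left; apply/eqP.
    ring.
Qed.

End boundary_barrier.

Section powers.
Context {R : realType}.
Implicit Types a b c h s x y : R.

Lemma powR_ler_neg a x y : a <= 0 -> 0 < x -> x <= y -> y `^ a <= x `^ a.
Proof.
move=> a0 x0 xy; have y0 : 0 < y by exact: lt_le_trans xy.
rewrite -[a]opprK !(powRN _ (- a)) lef_pV2 ?posrE ?powR_gt0//.
by apply: ge0_ler_powR; rewrite ?nnegrE ?oppr_ge0// ltW.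
Qed.

Lemma powRDp x a b : 0 < x -> x `^ (a + b) = x `^ a * x `^ b.
Proof. by move=> x0; rewrite powRD// (gt_eqF x0) implybT. Qed.

(* Weighted AM-GM, i.e. the tangent line inequality for the concave power. *)
Lemma powR_concave_diff a b c : 0 <= a <= b -> 0 < b -> 0 < c < 1 ->
  c * (b - a) * b `^ (c - 1) <= b `^ c - a `^ c.
Proof.
move=> /andP[a0 ab] b0 /andP[c0 c1].
have c10 : 0 < 1 - c by lra.
have x0 : 0 <= a / b by rewrite divr_ge0// ltW.
have : (a / b) `^ c * 1 <= (a / b) `^ c `^ c^-1 / c^-1 +
    1 `^ (1 - c)^-1 / (1 - c)^-1.
  apply: conjugate_powR; rewrite ?powR_ge0 ?invr_gt0// !invrK; lra.
rewrite powR1 -powRrM divff ?gt_eqF// powRr1// !invrK mulr1 mul1r => h.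
have -> : a `^ c = (a / b) `^ c * b `^ c.
  by rewrite -powRM ?divfK ?gt_eqF//; exact: ltW.
have bE : b `^ c = b * b `^ (c - 1) by rewrite mulr_powRB1// ltW.
have : (a / b) `^ c * b `^ c <= (a / b * c + (1 - c)) * b `^ c.
  by rewrite ler_wpM2r// powR_ge0.
suff -> : (a / b * c + (1 - c)) * b `^ c = b `^ c - c * (b - a) * b `^ (c - 1) by lra.
by rewrite bE; field; rewrite gt_eqF.
Qed.

Definition signed_power c s := if 0 <= s then s `^ c else - ((- s) `^ c).

Lemma signed_power_diff c h s : 0 < h -> 0 < c <= 1 / 2 ->
  c * h * (`|s| + h) `^ (c - 1) <= signed_power c (s + h) - signed_power c s.
Proof.
move=> h0 /andP[c0 c2]; rewrite /signed_power.
have c01 : 0 < c < 1 by lra.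
have c10 : c - 1 <= 0 by lra.
have [s0|s0] := leP 0 s.
  rewrite ger0_norm// addr_ge0//; last exact: ltW.
  have := @powR_concave_diff s (s + h) c; rewrite [s + h - s]addrC addKr.
  by apply; [rewrite s0/=; lra|lra|].
rewrite ltr0_norm//; have [sh|sh] := leP 0 (s + h).
  have cc : (- s + h) `^ (c - 1) <= h `^ (c - 1) by apply: powR_ler_neg; lra.
  have hE : h * h `^ (c - 1) = h `^ c by rewrite mulr_powRB1// ltW.
  have half : h `^ c / 2 <= (h / 2) `^ c.
    rewrite powRM ?invr_ge0 ?(ltW h0)// ler_wpM2l ?powR_ge0//.
    by apply: ger1_powR; [rewrite invr_gt0 invf_le1; lra|lra].
  have : (h / 2) `^ c <= (s + h) `^ c + (- s) `^ c.
    have [hs|hs] := leP (h / 2) (s + h).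
      apply: le_trans (_ : (s + h) `^ c <= _); last by rewrite lerDl powR_ge0.
      by apply: ge0_ler_powR; rewrite ?nnegrE; lra.
    apply: le_trans (_ : (- s) `^ c <= _); last by rewrite lerDr powR_ge0.
    by apply: ge0_ler_powR; rewrite ?nnegrE; lra.
  have : c * h * (- s + h) `^ (c - 1) <= c * h * h `^ (c - 1).
    by rewrite ler_wpM2l// mulr_ge0// ltW.
  rewrite -mulrA -[c * h * _ in X in _ <= X]mulrA hE opprK.
  have : c * h `^ c <= 1 / 2 * h `^ c by rewrite ler_wpM2r// powR_ge0.
  lra.
rewrite opprK; have := @powR_concave_diff (- (s + h)) (- s) c.
rewrite (_ : - s - - (s + h) = h); last by ring.
move=> H; apply: le_trans (_ : c * h * (- s) `^ (c - 1) <= _).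
  rewrite ler_wpM2l ?mulr_ge0 ?(ltW c0) ?(ltW h0)//; apply: powR_ler_neg; lra.
by rewrite [leRHS]addrC; apply: H => //; lra.
Qed.

Lemma signed_power_norm c s B : 0 < c <= 1 / 2 -> 1 <= B -> `|s| <= B ->
  `|signed_power c s| <= B.
Proof.
move=> c0 B1 sB; suff : `|s| `^ c <= B.
  rewrite /signed_power; have [s0|s0] := leP 0 s.
    by rewrite !ger0_norm// powR_ge0.
  by rewrite normrN ltr0_norm// (ger0_norm (powR_ge0 _ _)).
apply: le_trans (_ : B `^ c <= _); last by apply: ler1_powR => //; lra.
by apply: ge0_ler_powR; rewrite ?nnegrE//; lra.
Qed.

Lemma lattice_sum1 c h s B (N : nat) : 0 < h -> 0 < c <= 1 / 2 -> 1 <= B ->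
  `|s| <= B -> `|s + N%:R * h| <= B ->
  \sum_(k < N) h * (`|s + k%:R * h| + h) `^ (c - 1) <= 2 * B / c.
Proof.
move=> h0 c0 B1 sB sNB; rewrite ler_pdivlMr; last by lra.
pose f k := signed_power c (s + k%:R * h).
apply: le_trans (_ : \sum_(0 <= k < N) (f k.+1 - f k) <= _).
  rewrite big_mkord mulr_suml; apply: ler_sum => k _.
  have := signed_power_diff (s + k%:R * h) h0 c0.
  have -> : s + k%:R * h + h = s + k.+1%:R * h by rewrite -natr1; ring.
  rewrite /f; lra.
rewrite telescope_sumr// /f mul0r addr0.
have := signed_power_norm c0 B1 sB; have := signed_power_norm c0 B1 sNB.
rewrite !ler_norml; lra.
Qed.

(* Trades the kernel for a constant plus a small multiple of a more singular, but
   still summable, one. *)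
Lemma powR_interpolate (a : R) x t : 0 < x -> 0 < t -> 0 <= a ->
  x `^ (- a) <= t `^ (- a) + t `^ (1 / 4) * x `^ (- (a + 1 / 4)).
Proof.
move=> x0 t0 a0; have [tx|xt] := leP t x.
  apply: le_trans (_ : t `^ (- a) <= _).
    by apply: powR_ler_neg => //; lra.
  by rewrite lerDl mulr_ge0// powR_ge0.
apply: le_trans (_ : t `^ (1 / 4) * x `^ (- (a + 1 / 4)) <= _); last first.
  by rewrite lerDr powR_ge0.
rewrite (_ : - a = 1 / 4 + - (a + 1 / 4)); last by ring.
rewrite powRDp// ler_wpM2r ?powR_ge0//.
by apply: ge0_ler_powR; rewrite ?nnegrE; lra.
Qed.

End powers.

Section lattice.
Context {R : realType} {n : nat}.
Notation V := 'rV[R]_n.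

Definition lattice_point (lo h : R) (N : nat) (j : {ffun 'I_n -> 'I_N}) : V :=
  \row_i (lo + (j i)%:R * h).

Lemma lattice_sum (lo h B : R) (N : nat) (x : V) : (0 < n)%N -> 0 < h -> 1 <= B ->
  (forall i, `|lo - x 0 i| <= B) -> (forall i, `|lo - x 0 i + N%:R * h| <= B) ->
  \sum_(j : {ffun 'I_n -> 'I_N}) h ^+ n *
      (dot (x - lattice_point lo h j) (x - lattice_point lo h j) + h ^+ 2)
        `^ (- ((n%:R - 1) / 2 + 1 / 4))
    <= (8 * n%:R * B) ^+ n.
Proof.
move=> n0 h0 B1 lB NB; have nR0 : 1 <= n%:R :> R by rewrite ler1n.
pose c : R := 1 / (2 * n%:R).
have cn : c * n%:R = 1 / 2 by rewrite /c; field; lra.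
have c0 : 0 < c <= 1 / 2.
  apply/andP; split; first by rewrite /c divr_gt0//; lra.
  by rewrite -cn ler_peMr// /c divr_ge0//; lra.
have E : n%:R * ((c - 1) / 2) = - ((n%:R - 1) / 2 + 1 / 4).
  by rewrite mulrA mulrBr [n%:R * c]mulrC cn; field.
have cE : 2 * B / c = 4 * n%:R * B by rewrite /c; field; lra.
clearbody c; have [c0' c2] := andP c0.
pose F (i : 'I_n) (k : 'I_N) : R := 2 * (h * (`|lo - x 0 i + k%:R * h| + h) `^ (c - 1)).
apply: le_trans (_ : \sum_(j : {ffun 'I_n -> 'I_N}) \prod_i F i (j i) <= _).
  apply: ler_sum => j _; set y := lattice_point lo h j; set X := _ + h ^+ 2.
  have h20 : 0 < h ^+ 2 by rewrite exprn_gt0.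
  have X0 : 0 < X by rewrite ltr_wpDl// dot_ge0.
  rewrite -E [n%:R * _]mulrC powRrM powR_mulrn ?powR_ge0//.
  rewrite -exprMn -[X in _ ^+ X]card_ord -prodr_const.
  apply: ler_prod => i _; rewrite mulr_ge0 ?powR_ge0 ?(ltW h0)//= /F mulrCA.
  rewrite ler_pM2l//.
  set d := `|lo - x 0 i + (j i)%:R * h|; have d0 : 0 <= d by exact: normr_ge0.
  have dX : (d + h) ^+ 2 / 2 <= X.
    have := le_coord_dot (x - y) i; rewrite -/y -real_normK ?num_real//.
    have -> : `|(x - y) 0 i| = d.
      by rewrite !mxE -normrN; congr (`|_|); ring.
    have := sqr_ge0 (d - h); rewrite /X !expr2; lra.
  have dh0 : 0 < d + h by lra.
  have D0 : 0 < (d + h) ^+ 2 / 2 by rewrite divr_gt0// exprn_gt0.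
  apply: le_trans (_ : ((d + h) ^+ 2 / 2) `^ ((c - 1) / 2) <= _).
    by apply: powR_ler_neg => //; lra.
  rewrite powRM ?invr_ge0 ?exprn_ge0//; [|by lra].
  rewrite -(@powR_mulrn _ (d + h) 2) -?powRrM; last by lra.
  rewrite (_ : 2%:R * ((c - 1) / 2) = c - 1); last by field.
  rewrite mulrC ler_wpM2r ?powR_ge0//.
  have -> : 2^-1 `^ ((c - 1) / 2) = 2 `^ (- ((c - 1) / 2)) :> R.
    by rewrite -[- ((c - 1) / 2)]mulN1r (powRrM 2 (-1)) powR_inv1.
  rewrite -[leRHS]powRr1//.
  by apply: ler_powR; lra.
rewrite -bigA_distr_bigA -[X in _ <= _ ^+ X]card_ord -prodr_const.
apply: ler_prod => i _; apply/andP; split.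
  apply: sumr_ge0 => k _; rewrite /F !mulr_ge0 ?powR_ge0//; exact: ltW.
rewrite /F -mulr_sumr.
have := lattice_sum1 h0 c0 B1 (lB i) (NB i).
rewrite cE.
lra.
Qed.

End lattice.

Section integral_lower_bound.
Context {d : measure_display} {T : measurableType d} {R : realType}.
Variable mu : {measure set T -> \bar R}.
Import HBNNSimple.

Lemma nnsfun_sum_indic (I : Type) (s : seq I) (B : I -> set T) (c : I -> R) :
  (forall j, measurable (B j)) -> (forall j, 0 <= c j) ->
  exists h : {nnsfun T >-> R},
    (forall x, h x = \sum_(j <- s) c j * \1_(B j) x) /\
    (sintegral mu h = \sum_(j <- s) (c j)%:E * mu (B j))%E.
Proof.
move=> mB c0; elim: s => [|j s [h [hE hI]]].
  exists nnsfun0; split=> [x|]; first by rewrite big_nil.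
  by rewrite big_nil; exact: sintegral0.
exists (add_nnsfun (scale_nnsfun (indic_nnsfun R (mB j)) (c0 j)) h); split.
  by move=> x; rewrite big_cons -hE.
rewrite big_cons -hI /= (sintegralD mu (scale_nnsfun (indic_nnsfun R (mB j)) (c0 j)) h).
congr (_ + _)%E; rewrite /= (sintegralrM mu (c j) (indic_nnsfun R (mB j))).
by rewrite sintegral_indic.
Qed.

(* The definition of the integral as a supremum makes this hold for an arbitrary,
   possibly non-measurable, integrand. *)
Lemma integral_ge_disjoint_sum (D : set T) (f : T -> \bar R) (I : finType) (P : pred I)
    (B : I -> set T) (c : I -> R) :
  (forall x, D x -> (0 <= f x)%E) -> (forall j, measurable (B j)) ->
  (forall j, 0 <= c j) -> (forall i j x, B i x -> B j x -> i = j) ->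
  (forall j, P j -> B j `<=` D) ->
  (forall j x, P j -> B j x -> ((c j)%:E <= f x)%E) ->
  (\sum_(j | P j) (c j)%:E * mu (B j) <= \int[mu]_(x in D) f x)%E.
Proof.
move=> f0 mB c0 disj BD cf; rewrite ge0_integralE//.
have [h [hE hI]] := nnsfun_sum_indic [seq j <- index_enum I | P j] mB c0.
rewrite -big_filter -hI; apply: ereal_sup_ubound; exists h => // x /=.
have fD : (0 <= (f \_ D) x)%E.
  by rewrite /patch; case: ifPn => // /set_mem /f0.
have [[j [Pj Bjx]]|nB] := pselect (exists j, P j /\ B j x).
  have -> : h x = c j.
    rewrite hE big_filter (bigD1 j)//= big1 ?addr0.
      by rewrite indicE mem_set// mulr1.
    move=> i /andP[_ ij]; rewrite indicE memNset ?mulr0// => Bix.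
    by move/eqP : ij; apply; exact: disj Bix Bjx.
  by rewrite /patch mem_set; [exact: cf|exact: BD Bjx].
have -> : h x = 0; last exact: fD.
rewrite hE big_filter big1// => j Pj; rewrite indicE memNset ?mulr0// => Bjx.
by apply: nB; exists j.
Qed.

End integral_lower_bound.

Section boxes.
Context {R : realType} {n : nat}.

Definition box (a b : 'I_n -> R) : set (n.-tuple R) :=
  [set t | forall i, a i <= tnth t i <= b i].

Lemma measurable_box a b : measurable (box a b).
Proof.
rewrite (_ : box a b = \bigcap_(i in [set: 'I_n]) ((@tnth n R)^~ i @^-1` `[a i, b i])).
  apply: fin_bigcap_measurable => // i _.
  by rewrite -[X in measurable X]setTI; apply: measurable_tnth.
apply/seteqP; split=> t H i; first by move=> _; rewrite /= in_itv/=; exact: H.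
by have := H i I; rewrite /= in_itv.
Qed.

Lemma lebesgue_box (lam : {measure set (n.-tuple R) -> \bar R}) a b :
  is_lebesgue_measure lam -> (forall i, a i <= b i) ->
  lam (box a b) = (\prod_i (b i - a i))%:E.
Proof.
move=> L ab; have := L [tuple a i | i < n] [tuple b i | i < n].
rewrite (_ : [set t | _] = box a b); last first.
  by apply/seteqP; split=> t H i; have := H i; rewrite !tnth_mktuple.
move=> ->; last by move=> i; rewrite !tnth_mktuple.
by congr EFin; apply: eq_bigr => i _; rewrite !tnth_mktuple.
Qed.

Lemma measurable_open (Omega : set 'rV[R]_n) : open Omega ->
  measurable (tup2rV @^-1` Omega).
Proof.
move=> oO; pose U := {ffun 'I_n -> rat * rat}.
pose bx (p : U) := box (fun i => ratr (p i).1) (fun i => ratr (p i).2).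
rewrite (_ : _ @^-1` _ =
    \bigcup_(p : U) (if `[< bx p `<=` tup2rV @^-1` Omega >] then bx p else set0)).
  apply: countable_bigcupT_measurable => [|p]; first exact: countableP.
  by case: ifP => _; [exact: measurable_box|exact: measurable0].
apply/seteqP; split=> t; last first.
  by move=> [p _]; case: ifPn => // /asboolP H /H.
move=> /= Ot; have /nbhs_ballP[e /= e0 H] : nbhs (tup2rV t) Omega by exact: open_nbhs_nbhs.
have rq (i : 'I_n) : exists q : rat * rat,
    [/\ tnth t i - e < ratr q.1 :> R, ratr q.1 <= tnth t i :> R,
        tnth t i <= ratr q.2 :> R & ratr q.2 < tnth t i + e :> R].
  have l1 : tnth t i - e < tnth t i by rewrite ltrBlDr ltrDl.
  have l2 : tnth t i < tnth t i + e by rewrite ltrDl.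
  have [q1] := rat_in_itvoo l1; have [q2] := rat_in_itvoo l2.
  rewrite !in_itv/= => /andP[h1 h2] /andP[h3 h4].
  by exists (q1, q2); split=> //=; exact: ltW.
have [q Hq] := choice rq.
exists ([ffun i => q i]) => //; rewrite asboolT.
  by move=> i; rewrite !ffunE; have [_ -> ->] := Hq i.
move=> s Hs; apply: H; rewrite -ball_normE /ball_/=.
rewrite /Num.norm/= mx_normrE; apply: bigmax_lt => // -[a i] _ /=.
rewrite (ord1 a) !mxE; have := Hs i; rewrite !ffunE => /andP[h1 h2].
by have [k1 k2 k3 k4] := Hq i; rewrite ltr_norml; lra.
Qed.

Lemma lebesgue_bounded_open (lam : {measure set (n.-tuple R) -> \bar R})
    (Omega : set 'rV[R]_n) (M : R) : is_lebesgue_measure lam -> open Omega ->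
  (forall x, Omega x -> `|x| <= M) -> 0 <= M ->
  (lam (tup2rV @^-1` Omega) <= ((2 * M) ^+ n)%:E)%E.
Proof.
move=> L oO OM M0.
have := @lebesgue_box lam (fun=> - M) (fun=> M) L; rewrite prodr_const card_ord.
have -> : M - - M = 2 * M by ring.
move=> <-; last by move=> i; lra.
apply: le_measure; rewrite ?inE; [exact: measurable_open|exact: measurable_box|].
move=> t /= /OM tM i; have := le_trans (row_norm_ge (tup2rV t) i) tM.
by rewrite mxE ler_norml.
Qed.

End boxes.

Section kernel.
Context {R : realType}.

Lemma is_derive_shift_powR (a b q : R) : 0 < q + b ->
  is_derive q 1 (fun q => (q + b) `^ a) (a * (q + b) `^ (a - 1)).
Proof.
move=> qb; have d1 := is_derive1_powR a qb.
have d2 : is_derive q 1 (fun q : R => q + b) 1.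
  have := is_deriveD (@is_derive_id R _ q 1) (is_derive_cst b q 1).
  by rewrite addr0.
by have := @is_derive1_comp R (fun x => x `^ a) (fun q => q + b) q _ _ d1 d2; rewrite mulr1.
Qed.

Lemma is_derive_shift_ln (b q : R) : 0 < q + b ->
  is_derive q 1 (fun q => ln (q + b)) (q + b)^-1.
Proof.
move=> qb; have d1 := is_derive1_ln qb.
have d2 : is_derive q 1 (fun q : R => q + b) 1.
  have := is_deriveD (@is_derive_id R _ q 1) (is_derive_cst b q 1).
  by rewrite addr0.
by have := @is_derive1_comp R (@ln R) (fun q => q + b) q _ _ d1 d2; rewrite mulr1.
Qed.

(* [g] is, as a function of the squared distance, the fundamental solution of the
   Laplacian in dimension [n], regularised at scale [h]. *)
Lemma kernel_exists (n : nat) (D : R) : (0 < n)%N -> 0 <= D ->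
  exists C : R, 0 < C /\ forall h : R, 0 < h <= 1 -> exists g : R -> R,
    (forall q : R, 0 <= q -> is_derive q 1 g (- (q + h ^+ 2) `^ (- (n%:R / 2)))) /\
    (forall q : R, 0 <= q <= D -> `|g q| <= C * (q + h ^+ 2) `^ (- ((n%:R - 1) / 2))).
Proof.
move=> n0 D0.
have half (h q : R) : 0 < h <= 1 -> 0 <= q <= D ->
    (q + h ^+ 2) `^ (1 / 2) <= (D + 1) `^ (1 / 2).
  move=> /andP[h0 h1] qD; have h20 : 0 < h ^+ 2 by rewrite exprn_gt0.
  have h21 : h ^+ 2 <= 1 by rewrite exprn_ile1// ltW.
  by apply: ge0_ler_powR; rewrite ?nnegrE; lra.
have [->|n2] := eqVneq n 2%N.
  exists (4 * (D + 2)); split; first by lra.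
  move=> h h01; exists (fun q => - ln (q + h ^+ 2)).
  have h20 : 0 < h ^+ 2 by rewrite exprn_gt0//; lra.
  have h21 : h ^+ 2 <= 1 by rewrite exprn_ile1//; lra.
  split=> q q0.
    have X0 : 0 < q + h ^+ 2 by lra.
    by rewrite divff// powR_inv1 ?ltW//; apply: is_deriveN; exact: is_derive_shift_ln.
  rewrite normrN; set X := q + h ^+ 2; have X0 : 0 < X by rewrite /X; lra.
  have XD : X <= D + 1 by rewrite /X; lra.
  pose Y := X `^ (1 / 2); have Y0 : 0 < Y by exact: powR_gt0.
  have YY : Y * Y = X by rewrite -powRDp// (_ : 1 / 2 + 1 / 2 = 1) ?powRr1 ?ltW//; field.
  have -> : (2 - 1) / 2 = 1 / 2 :> R by field.
  rewrite powRN -/Y.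
  have -> : ln X = 2 * ln Y by rewrite -YY lnM ?posrE//; ring.
  have l1 : ln Y <= Y by have := le_ln1Dx (x := Y - 1); rewrite subrKC; lra.
  have l2 : - ln Y <= Y^-1.
    rewrite -lnV ?posrE//; have := le_ln1Dx (x := Y^-1 - 1); rewrite subrKC.
    by have := Y0; rewrite -invr_gt0; lra.
  have YV : Y <= (D + 1) * Y^-1 by rewrite ler_pdivlMr// YY.
  have V0 : 0 < Y^-1 by rewrite invr_gt0.
  have DV : 0 <= D * Y^-1 by rewrite mulr_ge0// ltW.
  by rewrite ler_norml; lra.
pose a : R := 1 - n%:R / 2.
have a0 : a != 0.
  rewrite /a subr_eq0 eq_sym; apply: contra_neq n2 => h.
  have : n%:R = 2 :> R by lra.
  by move/eqP; rewrite eqr_nat => /eqP.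
have aV0 : 0 < `|a^-1| by rewrite normr_gt0 invr_neq0.
exists (`|a^-1| * (D + 1) `^ (1 / 2)); split.
  by rewrite mulr_gt0// powR_gt0//; lra.
move=> h h01; exists (fun q => - (a^-1 * (q + h ^+ 2) `^ a)).
have h20 : 0 < h ^+ 2 by rewrite exprn_gt0//; lra.
split=> q q0.
  have X0 : 0 < q + h ^+ 2 by lra.
  have := is_deriveN (is_deriveZ a^-1 (is_derive_shift_powR a X0)).
  rewrite /GRing.scale/= mulrA mulVf// mul1r (_ : a - 1 = - (n%:R / 2))//.
  by rewrite /a; ring.
have X0 : 0 < q + h ^+ 2 by lra.
rewrite normrN normrM (ger0_norm (powR_ge0 _ _)) -mulrA ler_pM2l//.
rewrite (_ : a = 1 / 2 + - ((n%:R - 1) / 2)); last by rewrite /a; field.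
by rewrite powRDp// ler_wpM2r ?powR_ge0//; exact: half.
Qed.

Lemma kernel_line (n : nat) (h : R) (g : R -> R) (A B C : R) : 0 < h ->
  (forall q : R, 0 <= q -> is_derive q 1 g (- (q + h ^+ 2) `^ (- (n%:R / 2)))) ->
  (forall r : R, 0 <= A + B * r + C * r ^+ 2) ->
  is_derive (0 : R) 1 (fun r => g (A + B * r + C * r ^+ 2))
    (- ((A + h ^+ 2) `^ (- (n%:R / 2)) * B)) /\
  C2at0 (fun r => g (A + B * r + C * r ^+ 2))
    (n%:R / 2 * (A + h ^+ 2) `^ (- (n%:R / 2) - 1) * B ^+ 2 -
      (A + h ^+ 2) `^ (- (n%:R / 2)) * (2 * C)).
Proof.
move=> h0 dg Q0; set e := - (n%:R / 2).
have h20 : 0 < h ^+ 2 by rewrite exprn_gt0.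
pose Q (r : R) : R := A + B * r + C * r ^+ 2.
have A0 : Q 0 = A by rewrite /Q mulr0 expr0n/= mulr0 !addr0.
have d1 (r : R) : is_derive r 1 (fun r => g (Q r)) (- (Q r + h ^+ 2) `^ e * (B + 2 * C * r)).
  exact: (@is_derive1_comp R g Q r _ _ (dg _ (Q0 r)) (is_derive_quad A B C r)).
split.
  by have := d1 0; rewrite A0 mulr0 addr0 mulNr.
exists (fun r => - (Q r + h ^+ 2) `^ e * (B + 2 * C * r)); split.
  by exists 1 => // r _; exact: d1.
have X0 : 0 < Q 0 + h ^+ 2 by rewrite ltr_wpDl// Q0.
have dp := @is_derive1_comp R (fun q => (q + h ^+ 2) `^ e) Q 0 _ _
  (is_derive_shift_powR e X0) (is_derive_quad A B C 0).
have dl : is_derive (0 : R) 1 (fun r => B + 2 * C * r) (2 * C).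
  have := is_derive_quad B (2 * C) 0 0; rewrite mulr0 addr0; congr is_derive.
  by apply/funext => r; rewrite mul0r addr0.
have := is_deriveM (is_deriveN dp) dl.
rewrite /= -/(Q 0) A0 /GRing.scale/= !mulr0 !addr0 => -[H1 H2]; split=> //.
rewrite H2 fctE /= A0 /e; ring.
Qed.

End kernel.

Lemma is_derive_bigsum {R : realType} (I : Type) (s : seq I) (F : I -> R -> R)
    (dF : I -> R) (r : R) : (forall i, is_derive r 1 (F i) (dF i)) ->
  is_derive r 1 (fun r => \sum_(i <- s) F i r) (\sum_(i <- s) dF i).
Proof.
move=> H; elim: s => [|i s IH].
  rewrite big_nil (_ : (fun _ => _) = cst 0); first exact: is_derive_cst.
  by apply/funext => t; rewrite big_nil.
rewrite big_cons (_ : (fun _ => _) = F i + (fun r => \sum_(i <- s) F i r)).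
  exact: is_deriveD.
by apply/funext => t; rewrite big_cons.
Qed.

Section potential.
Context {R : realType} {n : nat} {I : finType}.
Notation V := 'rV[R]_n.
Variables (m : I -> R) (y : I -> V) (h : R) (g : R -> R).
Hypotheses (h0 : 0 < h) (m0 : forall j, 0 <= m j).
Hypothesis dg : forall q : R, 0 <= q -> is_derive q 1 g (- (q + h ^+ 2) `^ (- (n%:R / 2))).

Definition pot (x : V) : R := \sum_j m j * g (dot (x - y j) (x - y j)).

Let X (x : V) (j : I) : R := dot (x - y j) (x - y j) + h ^+ 2.

Let X_gt0 x j : 0 < X x j.
Proof. by rewrite ltr_wpDl ?dot_ge0// exprn_gt0. Qed.

Let dist_line (x p : V) (r : R) j : dot (x + r *: p - y j) (x + r *: p - y j) =
  dot (x - y j) (x - y j) + 2 * dot (x - y j) p * r + dot p p * r ^+ 2.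
Proof. by rewrite addrAC dot_quad; ring. Qed.

Let pot_line (x p : V) : (fun r => pot (x + r *: p)) = (fun r => \sum_j m j *
  g (dot (x - y j) (x - y j) + 2 * dot (x - y j) p * r + dot p p * r ^+ 2)).
Proof. by apply/funext => r; apply: eq_bigr => j _; rewrite dist_line. Qed.

Let kline (x p : V) j := kernel_line (A := dot (x - y j) (x - y j))
  (B := 2 * dot (x - y j) p) (C := dot p p) h0 dg.

Let line_ge0 (x p : V) j (r : R) :
  0 <= dot (x - y j) (x - y j) + 2 * dot (x - y j) p * r + dot p p * r ^+ 2.
Proof. by rewrite -dist_line dot_ge0. Qed.

Lemma pot_continuous : continuous pot.
Proof.
have := @continuous_bigsum R V I (index_enum _) (fun j x => m j * g (dot (x - y j) (x - y j))).
apply => j x.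
have cd : (fun x : V => dot (x - y j) (x - y j)) @ x --> dot (x - y j) (x - y j).
  have sw z : dot (z - y j) (z - y j) = dot (y j - z) (y j - z).
    by rewrite -opprB dotNl dotNr opprK.
  by under eq_fun do rewrite sw; rewrite sw; exact: (@continuous_sqdist R n (y j) x).
have cg : {for dot (x - y j) (x - y j), continuous g}.
  have [d _] := dg (dot_ge0 (x - y j)).
  by apply: differentiable_continuous; exact/derivable1_diffP.
exact: (cvgM (cvg_cst (m j)) (continuous_cvg _ cg cd)).
Qed.

Lemma pot_derive (x p : V) : is_derive (0 : R) 1 (fun r => pot (x + r *: p))
  (\sum_j m j * - (X x j `^ (- (n%:R / 2)) * (2 * dot (x - y j) p))).
Proof.
rewrite pot_line; apply: is_derive_bigsum => j.
exact: (is_deriveZ (m j) (kline (line_ge0 x p j)).1).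
Qed.

Lemma pot_laplacian (x : V) : exists l : 'I_n -> R,
  \sum_i l i = - \sum_j m j * (2 * n%:R * h ^+ 2 * X x j `^ (- (n%:R / 2) - 1)) /\
  forall i, C2at0 (fun r => pot (x + r *: ebasis i)) (l i).
Proof.
set e := - (n%:R / 2).
exists (fun i => \sum_j m j * (n%:R / 2 * X x j `^ (e - 1) *
  (2 * dot (x - y j) (ebasis i)) ^+ 2 - X x j `^ e * (2 * dot (ebasis i) (ebasis i)))).
split; last first.
  move=> i; rewrite pot_line; apply: C2at0_sum => j.
  exact: (C2at0Z (m j) (kline (line_ge0 x (ebasis i) j)).2).
rewrite exchange_big/= -sumrN; apply: eq_bigr => j _.
rewrite -mulr_sumr -mulrN; congr (_ * _).
have XE : X x j `^ e = X x j * X x j `^ (e - 1).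
  by rewrite -{2}[X x j]powRr1 ?(ltW (X_gt0 _ _))// -powRDp// addrC subrK.
rewrite big_split/= sumrN -mulr_sumr.
have -> : \sum_(i < n) X x j `^ e * (2 * dot (ebasis i) (ebasis i)) =
    2 * n%:R * X x j `^ e.
  rewrite (eq_bigr (fun=> 2 * X x j `^ e)); last first.
    by move=> i _; rewrite dot_ebasis mxE !eqxx mulr1 mulrC.
  by rewrite sumr_const card_ord -mulr_natl; ring.
have -> : \sum_(i < n) (2 * dot (x - y j) (ebasis i)) ^+ 2 =
    4 * dot (x - y j) (x - y j).
  rewrite mulr_sumr; apply: eq_bigr => i _; rewrite dot_ebasis; ring.
by rewrite XE /X; field.
Qed.

Lemma pot_norm_le (x : V) (C D : R) :
  (forall q : R, 0 <= q <= D -> `|g q| <= C * (q + h ^+ 2) `^ (- ((n%:R - 1) / 2))) ->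
  (forall j, m j = 0 \/ dot (x - y j) (x - y j) <= D) ->
  `|pot x| <= C * \sum_j m j * X x j `^ (- ((n%:R - 1) / 2)).
Proof.
move=> gC mD; rewrite mulr_sumr; apply: le_trans (ler_norm_sum _ _ _) _.
apply: ler_sum => j _; have [->|dD] := mD j; first by rewrite !mul0r normr0 mulr0.
rewrite normrM (ger0_norm (m0 j)) mulrCA ler_wpM2l//.
by apply: gC; rewrite dot_ge0.
Qed.

Lemma pot_derive_le (x p : V) :
  `|\sum_j m j * - (X x j `^ (- (n%:R / 2)) * (2 * dot (x - y j) p))| <=
  2 * n%:R * `|p| * \sum_j m j * X x j `^ (- ((n%:R - 1) / 2)).
Proof.
rewrite mulr_sumr; apply: le_trans (ler_norm_sum _ _ _) _; apply: ler_sum => j _.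
rewrite normrM (ger0_norm (m0 j)) [leRHS]mulrCA ler_wpM2l// normrN normrM.
rewrite (ger0_norm (powR_ge0 _ _)) normrM (ger0_norm (ler0n _ 2)).
have -> : - ((n%:R - 1) / 2) = - (n%:R / 2) + 1 / 2 :> R by field.
rewrite powRDp//; set Xe := _ `^ _; have Xe0 : 0 <= Xe by exact: powR_ge0.
have xX : `|x - y j| <= X x j `^ (1 / 2).
  apply: le_trans (_ : (`|x - y j| ^+ 2) `^ (1 / 2) <= _).
    have h2 : 2%:R * (1 / 2) = 1 :> R by field.
    by rewrite -powR_mulrn// -powRrM h2 powRr1.
  apply: ge0_ler_powR; rewrite ?nnegrE ?exprn_ge0 ?(ltW (X_gt0 _ _))//.
  by apply: le_trans (sqr_norm_le_dot _) _; rewrite lerDl exprn_ge0// ltW.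
have := norm_dot_le (x - y j) p => dp.
have : n%:R * `|x - y j| * `|p| <= n%:R * X x j `^ (1 / 2) * `|p|.
  by rewrite ler_wpM2r// ler_wpM2l.
move=> /(le_trans dp) dp'.
have : 2 * Xe * `|dot (x - y j) p| <= 2 * Xe * (n%:R * X x j `^ (1 / 2) * `|p|).
  by rewrite ler_wpM2l// mulr_ge0.
lra.
Qed.

End potential.

Definition grid_size {R : realType} (M h : R) : nat :=
  (Num.truncn ((2 * M + 1) / h)).+1.

Notation grid n M h := {ffun 'I_n -> 'I_(grid_size M h)}.

Section grid.
Context {R : realType} {n : nat}.
Notation V := 'rV[R]_n.

Definition grid_point (M h : R) (j : grid n M h) : V :=
  lattice_point (- (M + 1)) h j.

Definition grid_inside (Omega : set V) (M h : R) (j : grid n M h) :=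
  `[< forall z, `|z - grid_point j| <= h / 3 -> Omega z >].

Variables (Omega : set V) (M : R).
Variable lam : {measure set (n.-tuple R) -> \bar R}.
Hypotheses (M0 : 0 < M) (OM : forall x, closure Omega x -> `|x| <= M).
Hypothesis L : is_lebesgue_measure lam.


Lemma grid_size_le (h : R) : 0 < h <= 1 -> (grid_size M h)%:R * h <= 2 * M + 2.
Proof.
move=> /andP[h0 h1]; have M0' := M0.
have q0 : 0 <= (2 * M + 1) / h by rewrite divr_ge0//; lra.
have /andP[+ _] := truncn_itv q0; rewrite ler_pdivlMr// => H.
by rewrite /grid_size -natr1 mulrDl mul1r; lra.
Qed.

Lemma grid_inside_mem (h : R) (j : grid n M h) : 0 < h ->
  grid_inside Omega j -> Omega (grid_point j).
Proof.
by move=> h0 /asboolP; apply; rewrite subrr normr0 divr_ge0// ltW.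
Qed.

Lemma exists_grid_inside (h : R) (z : V) : 0 < h <= 1 -> `|z| <= M ->
  (forall y, `|y - z| <= 2 * h -> Omega y) ->
  exists2 j : grid n M h, grid_inside Omega j & `|z - grid_point j| <= h.
Proof.
move=> /andP[h0 h1] zM H; have M0' := M0.
have zlo i : 0 <= z 0 i - (- (M + 1)) <= 2 * M + 1.
  by have := le_trans (row_norm_ge z i) zM; rewrite ler_norml ; lra.
have kP (i : 'I_n) : (Num.truncn ((z 0 i - (- (M + 1))) / h)%R < grid_size M h)%N.
  rewrite /grid_size ltnS; apply: le_truncn; rewrite ler_pM2r ?invr_gt0//.
  by have := zlo i; lra.
pose j : grid n M h := [ffun i => Ordinal (kP i)].
have zy : `|z - grid_point j| <= h.
  apply: row_norm_le => [|i]; first exact: ltW.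
  rewrite !mxE ffunE /=.
  have q0 : 0 <= (z 0 i - (- (M + 1))) / h by rewrite divr_ge0 ?(ltW h0)//; have := zlo i; lra.
  have := truncn_itv q0; set k := Num.truncn _; rewrite -natr1 ler_pdivlMr//.
  by rewrite ltr_pdivrMr// mulrDl mul1r => H1; rewrite ler_norml; lra.
exists j => //; apply/asboolP => w wy; apply: H.
rewrite (_ : w - z = (w - grid_point j) - (z - grid_point j)); last by rewrite opprB addrA subrK.
by apply: le_trans (ler_normB _ _) _; lra.
Qed.

Lemma riemann_sum_le (f : V -> R) (h e : R) : 0 < h <= 1 -> 0 <= e ->
  (forall x, closure Omega x -> 0 <= f x) ->
  (forall x y, closure Omega x -> closure Omega y -> `|x - y| <= h ->
     `|f x - f y| <= e) ->
  ((\sum_(j : grid n M h | grid_inside Omega j) (2 * h / 3) ^+ n * f (grid_point j))%:E <=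
   \int[lam]_(t in tup2rV @^-1` Omega) (f (tup2rV t))%:E +
     (e * (2 * M + 2) ^+ n)%:E)%E.
Proof.
move=> h01 e0 f0 fu; have M0' := M0; have [h0 h1] := andP h01.
pose c (j : grid n M h) := Num.max (f (grid_point j) - e) 0.
pose B (j : grid n M h) :=
  box (fun i => grid_point j 0 i - h / 3) (fun i => grid_point j 0 i + h / 3).
have lamB j : lam (B j) = ((2 * h / 3) ^+ n)%:E.
  rewrite lebesgue_box// => [|i]; last by lra.
  rewrite (eq_bigr (fun=> 2 * h / 3)); last by move=> i _; field.
  by rewrite prodr_const card_ord.
have Byp j t : B j t -> `|tup2rV t - grid_point j| <= h / 3.
  move=> Bt; apply: row_norm_le => [|i]; first by lra.
  by have := Bt i; rewrite [(tup2rV t - _) 0 i]mxE [tup2rV t 0 i]mxE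
    [(- grid_point j) 0 i]mxE ler_norml; lra.
have BO j t : grid_inside Omega j -> B j t -> Omega (tup2rV t).
  by move=> /asboolP + /Byp; apply.
have := @integral_ge_disjoint_sum _ _ R lam (tup2rV @^-1` Omega)
  (fun t => (f (tup2rV t))%:E) _ (grid_inside Omega (M := M) (h := h)) B c.
have -> : (\sum_(j : grid n M h | grid_inside Omega j) (c j)%:E * lam (B j))%E =
    (\sum_(j : grid n M h | grid_inside Omega j) (2 * h / 3) ^+ n * c j)%:E.
  by rewrite -sumEFin; apply: eq_bigr => j _; rewrite lamB -EFinM mulrC.
move=> H; apply: le_trans (_ :
    ((\sum_(j : grid n M h | grid_inside Omega j) (2 * h / 3) ^+ n * c j)%:E
      + (e * (2 * M + 2) ^+ n)%:E <= _)%E); last first.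
  apply: leeD => //; apply: H.
  - by move=> t Ot; rewrite lee_fin; apply: f0; exact: subset_closure.
  - by move=> j; exact: measurable_box.
  - by move=> j; rewrite le_max lexx orbT.
  - move=> i j t Bi Bj; apply/ffunP => k; apply/val_inj => /=.
    have := Bi k; have := Bj k; rewrite ![grid_point _ 0 k]mxE => Hj Hi.
    have d1 : ((i k)%:R - (j k)%:R) * h < h by lra.
    have d2 : ((j k)%:R - (i k)%:R) * h < h by lra.
    move: d1 d2; rewrite -[ltRHS]mul1r ltr_pM2r// -[X in _ < X -> _]mul1r => d1.
    rewrite -[ltRHS]mul1r ltr_pM2r// => d2.
    by apply/eqP; rewrite eqn_leq; apply/andP; split; rewrite -ltnS -(ltr_nat R) -natr1; lra.
  - by move=> j ij t Bt; exact: BO Bt.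
  - move=> j t ij Bt; rewrite lee_fin /c ge_max; apply/andP; split; last first.
      by apply: f0; apply: subset_closure; exact: BO Bt.
    have Cy : closure Omega (grid_point j) by apply: subset_closure; exact: grid_inside_mem.
    have Ct : closure Omega (tup2rV t) by apply: subset_closure; exact: BO Bt.
    have := fu _ _ Cy Ct; rewrite distrC ler_norml; have := Byp j t Bt => d.
    have -> : `|tup2rV t - grid_point j| <= h by lra.
    by move=> /(_ isT); lra.
rewrite -EFinD lee_fin.
apply: le_trans (_ : \sum_(j : grid n M h | grid_inside Omega j) ((2 * h / 3) ^+ n * c j
    + (2 * h / 3) ^+ n * e) <= _).
  apply: ler_sum => j _; rewrite -mulrDr ler_wpM2l ?exprn_ge0//; first by lra.
  by rewrite -lerBlDr /c le_max lexx.
rewrite big_split/= lerD2l.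
apply: le_trans (_ : \sum_(j : grid n M h) h ^+ n * e <= _).
  rewrite [leRHS](bigID (grid_inside Omega (M := M) (h := h)))/=; apply: ler_wpDr.
    by apply: sumr_ge0 => j _; rewrite mulr_ge0// exprn_ge0// ltW.
  apply: ler_sum => j _; rewrite ler_wpM2r// lerXn2r ?nnegrE//; lra.
rewrite sumr_const card_ffun !card_ord -[leLHS]mulr_natl mulrA natrX -exprMn mulrC.
rewrite ler_wpM2l// lerXn2r ?nnegrE//; last exact: grid_size_le.
  by rewrite mulr_ge0// ltW.
by lra.
Qed.

End grid.

Lemma small_potential {R : realType} {n : nat} (Omega : set 'rV[R]_n)
    (phi : 'rV[R]_n -> R) (M : R) (lam : {measure set (n.-tuple R) -> \bar R})
    (P kappa : R) :
  Omega !=set0 -> defining_function Omega phi -> 0 < M ->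
  (forall x, closure Omega x -> `|x| <= M) -> is_lebesgue_measure lam -> (0 < n)%N ->
  0 < P -> 0 < kappa ->
  exists2 delta : R, 0 < delta & forall f : 'rV[R]_n -> R,
    {within closure Omega, continuous f} ->
    (forall x, closure Omega x -> 0 <= f x <= 1) ->
    (\int[lam]_(t in tup2rV @^-1` Omega) (f (tup2rV t))%:E < delta%:E)%E ->
  exists p : 'rV[R]_n -> R, [/\ {within closure Omega, continuous p},
    forall x, closure Omega x -> `|p x| <= kappa,
    forall x, closure Omega x -> exists l : 'I_n -> R,
      \sum_i l i <= kappa - f x /\
      forall i, C2at0 (fun r => p (x + r *: ebasis i)) (l i) &
    forall x v, closure Omega x -> `|v| <= P -> exists2 d : R, `|d| <= kappa &
      is_derive (0 : R) 1 (fun r => p (x + r *: v)) d].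
Proof.
move=> O0 dphi M0' OM L n0 P0 k0; have nR1 : 1 <= n%:R :> R by rewrite ler1n.
have [C0 [h0 [C00 h00 ball_in]]] := inner_ball O0 dphi OM.
pose D : R := n%:R * (2 * M) * (2 * M).
have D0 : 0 <= D by rewrite !mulr_ge0//; lra.
have [C [Cgt0 kern]] := kernel_exists n0 D0.
pose C' : R := 2 * C0 + 1; have C'1 : 1 < C' by rewrite /C'; lra.
pose E : R := n%:R * C' ^+ 2 + 1.
have E0 : 0 < E by rewrite ltr_wpDl// mulr_ge0// exprn_ge0//; lra.
pose en : R := n%:R / 2 + 1.
pose Cm : R := E `^ en / (2 * n%:R).
have Cm0 : 0 < Cm by rewrite divr_gt0 ?powR_gt0//; lra.
pose W : R := (8 * n%:R * (2 * M + 2)) ^+ n.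
have W0 : 0 < W by rewrite exprn_gt0// !mulr_gt0//; lra.
have CmE : Cm = E `^ en / (2 * n%:R) by [].
have WE : W = (8 * n%:R * (2 * M + 2)) ^+ n by [].
clearbody Cm W.
pose K' : R := kappa / (C + 2 * n%:R * P + 1).
have CP0 : 0 < C + 2 * n%:R * P + 1.
  by have : 0 < 2 * n%:R * P; [rewrite !mulr_gt0//; lra|lra].
have K'0 : 0 < K' by rewrite divr_gt0.
have K'E : K' * (C + 2 * n%:R * P + 1) = kappa by rewrite /K' divfK ?gt_eqF.
pose rt : R := K' / (2 * Cm * W); have rt0 : 0 < rt.
  by apply: divr_gt0 => //; apply: mulr_gt0 => //; exact: mulr_gt0.
have rtE : rt * Cm * W = K' / 2 by rewrite /rt; field; rewrite !gt_eqF.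
pose tau : R := rt ^+ 4; have tau0 : 0 < tau by exact: exprn_gt0.
have tauE : tau `^ (1 / 4) = rt.
  rewrite /tau -powR_mulrn ?(ltW rt0)// -powRrM (_ : 4%:R * (1 / 4) = 1) ?powRr1 ?(ltW rt0)//.
  by field.
clearbody tau rt K'.
pose a : R := (n%:R - 1) / 2; have a0 : 0 <= a by rewrite divr_ge0//; lra.
pose ta : R := tau `^ (- a); have ta0 : 0 < ta by exact: powR_gt0.
pose s0 : R := K' / 2 / (ta * Cm).
have s00 : 0 < s0 by apply: divr_gt0; [exact: divr_gt0|exact: mulr_gt0].
have s0E : ta * (Cm * s0) = K' / 2 by rewrite /s0; field; rewrite !gt_eqF.
clearbody s0.
pose t3 : R := (2 / 3) ^+ n; have t30 : 0 < t3 by rewrite exprn_gt0//; lra.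
exists (t3 * s0 / 2); first by rewrite divr_gt0// mulr_gt0.
move=> f fc f01 intf.
pose e : R := t3 * s0 / 2 / (2 * M + 2) ^+ n.
have B0 : 0 < (2 * M + 2) ^+ n by rewrite exprn_gt0// addr_gt0// mulr_gt0.
have e0 : 0 < e by rewrite divr_gt0// divr_gt0// mulr_gt0.
have eE : e * (2 * M + 2) ^+ n = t3 * s0 / 2 by rewrite /e divfK// gt_eqF.
have mek : 0 < Num.min e kappa by rewrite lt_min e0.
have [dl dl0 fu] := compact_uniform_continuity (compact_closure_domain OM) fc mek.
have meke : Num.min e kappa <= e by rewrite ge_min lexx.
have mekk : Num.min e kappa <= kappa by rewrite ge_min lexx orbT.
pose mm : R := Num.min (Num.min 1 h0) dl.
have mm0 : 0 < mm by rewrite !lt_min ltr01 h00.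
have mm1 : mm <= 1 by rewrite !ge_min lexx.
have mmh : mm <= h0 by rewrite !ge_min lexx orbT.
have mmd : mm <= dl by rewrite !ge_min lexx !orbT.
pose h : R := mm / (4 * C').
have C40 : 0 < 4 * C' by move: C'1; clear; lra.
have hC : h * (4 * C') = mm by rewrite /h divfK// gt_eqF.
have hgt0 : 0 < h by rewrite divr_gt0.
have hC1 : h <= h * C' by rewrite ler_peMr// ltW.
clearbody h mm.
have h01 : 0 < h <= 1 by move: mm0 mm1 hC hC1 hgt0; clear; lra.
have [g [dg gC]] := kern h h01.
pose m (j : grid n M h) : R :=
  if grid_inside Omega j then Cm * h ^+ n * f (grid_point j) else 0.
have hn0 : 0 < h ^+ n by exact: exprn_gt0.
have Chn0 : 0 < Cm * h ^+ n by exact: mulr_gt0.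
have fy (j : grid n M h) : grid_inside Omega j -> 0 <= f (grid_point j) <= 1.
  by move=> ij; apply/f01/subset_closure; exact: grid_inside_mem ij.
have m0 j : 0 <= m j <= Cm * h ^+ n.
  rewrite /m; case: ifPn => [/fy/andP[fj0 fj1]|_]; last by rewrite lexx ltW.
  by rewrite mulr_ge0 ?ler_piMr ?(ltW Chn0).
have m0' j : 0 <= m j by have /andP[] := m0 j.
have summ : \sum_j m j <= Cm * s0.
  have -> : \sum_j m j = Cm * (t3^-1 * \sum_(j : grid n M h | grid_inside Omega j)
      (2 * h / 3) ^+ n * f (grid_point j)).
    rewrite /m -big_mkcond/= !mulr_sumr; apply: eq_bigr => j _.
    have -> : (2 * h / 3) ^+ n = t3 * h ^+ n.
      by rewrite /t3 -exprMn; congr (_ ^+ _); field.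
    by rewrite -[t3 * _ * _]mulrA mulKf ?gt_eqF// mulrA.
  rewrite ler_pM2l// mulrC ler_pdivrMr//.
  have := @riemann_sum_le R n Omega M lam M0' L f h e h01 (ltW e0); rewrite -lee_fin => H.
  have {}H := H (fun x cx => proj1 (andP (f01 x cx))).
  apply: le_trans (H _) _.
    move=> x x' cx cx' xx'; apply: ltW; apply: lt_le_trans meke.
    apply: fu => //; apply: le_lt_trans xx' _.
    by move: mm0 mmd hC hC1 hgt0; clear; lra.
  rewrite eE (_ : s0 * t3 = t3 * s0 / 2 + t3 * s0 / 2); last by field.
  by rewrite EFinD leeD2r// ltW.
pose X (x : 'rV[R]_n) (j : grid n M h) : R := dot (x - grid_point j) (x - grid_point j) + h ^+ 2.
have h20 : 0 < h ^+ 2 by exact: exprn_gt0.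
have X0 x j : 0 < X x j by rewrite ltr_wpDl ?dot_ge0.
have small x : closure Omega x -> \sum_j m j * X x j `^ (- a) <= K'.
  move=> cx; have xM := OM _ cx.
  apply: le_trans (_ : \sum_j (ta * m j + rt * Cm *
      (h ^+ n * X x j `^ (- (a + 1 / 4)))) <= _).
    apply: ler_sum => j _.
    have := powR_interpolate (X0 x j) tau0 a0; rewrite tauE -/ta => Hi.
    apply: le_trans (ler_wpM2l (m0' j) Hi) _.
    rewrite mulrDr; apply: lerD; first by rewrite mulrC.
    set Z := _ `^ _; have Z0 : 0 <= rt * Z by rewrite mulr_ge0 ?powR_ge0// ltW.
    apply: le_trans (_ : Cm * h ^+ n * (rt * Z) <= _).
      by rewrite ler_wpM2r//; have /andP[] := m0 j.
    by rewrite le_eqVlt; apply/orP; left; apply/eqP; ring.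
  rewrite big_split/=.
  have -> : \sum_j ta * m j = ta * \sum_j m j by rewrite mulr_sumr.
  have -> : \sum_j rt * Cm * (h ^+ n * X x j `^ (- (a + 1 / 4))) =
      rt * Cm * \sum_j h ^+ n * X x j `^ (- (a + 1 / 4)) by rewrite mulr_sumr.
  have xi i : - M <= x 0 i <= M.
    by have := le_trans (row_norm_ge x i) xM; rewrite ler_norml.
  have := @lattice_sum R n (- (M + 1)) h (2 * M + 2) (grid_size M h) x n0 hgt0.
  have -> : 1 <= 2 * M + 2 by move: M0'; clear; lra.
  have sz := grid_size_le M0' h01; have sz0 : 0 <= (grid_size M h)%:R * h by rewrite mulr_ge0// ltW.
  move=> /(_ isT) ls; have {}ls : \sum_j h ^+ n * X x j `^ (- (a + 1 / 4)) <= W.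
    by rewrite WE; apply: ls => i; move: (xi i) sz sz0 M0'; rewrite ler_norml ; clear; lra.
  have : ta * \sum_j m j <= ta * (Cm * s0) by rewrite ler_pM2l.
  have : rt * Cm * \sum_j h ^+ n * X x j `^ (- (a + 1 / 4)) <= rt * Cm * W.
    by rewrite ler_pM2l// mulr_gt0.
  by rewrite rtE s0E; clear; lra.
have gK x : closure Omega x -> 0 <= \sum_j m j * X x j `^ (- a).
  by move=> _; apply: sumr_ge0 => j _; rewrite mulr_ge0// powR_ge0.
have CK : C * K' <= kappa /\ 2 * n%:R * P * K' <= kappa.
  have : 0 < C * K' by exact: mulr_gt0.
  have : 0 < 2 * n%:R * P * K' by rewrite !mulr_gt0// ltr0n.
  by rewrite -K'E; move: K'0; clear; lra.
exists (pot m (grid_point (M := M) (h := h)) g); split.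
- by apply: continuous_subspaceT => x; exact: (pot_continuous dg).
- move=> x cx; have := @pot_norm_le R n _ m (grid_point (M := M) (h := h)) h g m0' x C D gC.
  have mD (j : grid n M h) : m j = 0 \/ dot (x - grid_point j) (x - grid_point j) <= D.
    rewrite /m; case: ifPn => [ij|_]; [right|by left].
    have yM : `|grid_point j| <= M by apply: OM; apply: subset_closure; exact: grid_inside_mem.
    have xy : `|x - grid_point j| <= 2 * M.
      apply: le_trans (ler_normB _ _) _; move: (OM _ cx) yM; clear; lra.
    apply: le_trans (ler_norm _) _; apply: le_trans (norm_dot_le _ _) _.
    by apply: ler_pM; rewrite ?mulr_ge0// ler_wpM2l.
  move=> /(_ mD) H; apply: le_trans H _; apply: le_trans CK.1.
  by rewrite ler_pM2l//; exact: small.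
- move=> x cx; have [l [lE lC]] := @pot_laplacian R n _ m (grid_point (M := M) (h := h)) h g hgt0 dg x.
  exists l; split=> //; rewrite lE.
  have hh0 : 0 < 2 * h < h0 by move: mm0 mmh hC hC1 hgt0; clear; lra.
  have [z zx zO] := ball_in x (2 * h) cx hh0.
  have cz : closure Omega z.
    by apply/subset_closure/zO; rewrite subrr normr0 mulr_ge0// ltW.
  have [j ij zy] := exists_grid_inside M0' h01 (OM _ cz) zO.
  have xy : `|x - grid_point j| <= C' * h.
    rewrite (_ : x - grid_point j = (x - z) + (z - grid_point j)); last by rewrite addrA subrK.
    apply: le_trans (ler_normD _ _) _; by rewrite [`|x - z|]distrC /C'; move: zx zy; clear; lra.
  have Cy : closure Omega (grid_point j) by apply: subset_closure; exact: grid_inside_mem.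
  have fxy : `|x - grid_point j| < dl.
    by move: xy mm0 mmd hC hC1 hgt0; clear; lra.
  have := fu _ _ cx Cy fxy; rewrite ltr_norml => /andP[_ fxy'].
  have XE : X x j <= E * h ^+ 2.
    rewrite /X /E mulrDl mul1r lerD2r.
    apply: le_trans (ler_norm _) _; apply: le_trans (norm_dot_le _ _) _.
    rewrite (_ : n%:R * C' ^+ 2 * h ^+ 2 = n%:R * (C' * h * (C' * h))); last by ring.
    by rewrite -mulrA ler_wpM2l//; apply: ler_pM.
  suff : f (grid_point j) <= \sum_j m j * (2 * n%:R * h ^+ 2 * X x j `^ (- (n%:R / 2) - 1)).
    by move: fxy' mekk; rewrite /X; clear; lra.
  rewrite (bigD1 j)//= ler_wpDr//.
    apply: sumr_ge0 => i _; rewrite !mulr_ge0// ?powR_ge0// ltW//.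
  have -> : - (n%:R / 2) - 1 = - en by rewrite /en; ring.
  have en0 : - en <= 0 by rewrite oppr_le0 /en addr_ge0// divr_ge0.
  have XX : (E * h ^+ 2) `^ (- en) <= X x j `^ (- en) by exact: powR_ler_neg.
  have EhE : h ^+ n * (h ^+ 2 * (E * h ^+ 2) `^ (- en)) = (E `^ en)^-1.
    rewrite powRM ?(ltW E0) ?(ltW h20)// (powRN E).
    have -> : (h ^+ 2) `^ (- en) = (h ^+ n * h ^+ 2)^-1.
      rewrite powRN -exprD -!powR_mulrn ?(ltW hgt0)// -powRrM; congr (_ `^ _)^-1.
      by rewrite /en natrD; field.
    have := powR_gt0 en E0 => ?.
    by field; rewrite !gt_eqF.
  rewrite {1}/m ij.
  apply: le_trans (_ : Cm * h ^+ n * f (grid_point j) *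
      (2 * n%:R * h ^+ 2 * (E * h ^+ 2) `^ (- en)) <= _); last first.
    rewrite ler_wpM2l//; first by have /andP[fj0 _] := fy j ij; rewrite mulr_ge0 ?(ltW Chn0).
    by rewrite ler_wpM2l// !mulr_ge0// ltW.
  rewrite le_eqVlt; apply/orP; left; apply/eqP.
  have -> : Cm * h ^+ n * f (grid_point j) *
      (2 * n%:R * h ^+ 2 * (E * h ^+ 2) `^ (- en)) =
    Cm * (2 * n%:R) * (h ^+ n * (h ^+ 2 * (E * h ^+ 2) `^ (- en))) * f (grid_point j) by ring.
  rewrite EhE CmE; have := powR_gt0 en E0 => ?.
  by field; rewrite !gt_eqF ?ltr0n.
- move=> x v cx vP; exists (\sum_j m j * - (X x j `^ (- (n%:R / 2)) *
      (2 * dot (x - grid_point j) v))); last exact: (@pot_derive R n _ m (grid_point (M := M) (h := h)) h g hgt0 dg x v).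
  apply: le_trans (@pot_derive_le R n _ m (grid_point (M := M) (h := h)) h hgt0 m0' x v) _.
  apply: le_trans CK.2; apply: ler_pM.
  + by rewrite !mulr_ge0.
  + exact: (gK x).
  + by rewrite ler_wpM2l// mulr_ge0.
  + exact: small.
Qed.


Section barriers.
Context {R : realType} {n : nat}.
Notation V := 'rV[R]_n.
Implicit Types (Omega : set V) (N : V -> V) (Phi f : V -> R).

Record barrier Omega N f Phi (kappa : R) : Prop := Barrier {
  bar_cont : {within closure Omega, continuous Phi} ;
  bar_norm : forall x, closure Omega x -> `|Phi x| <= kappa ;
  bar_above : forall x, closure Omega x -> touched_above Phi x (kappa - f x) ;
  bar_incr : forall x, closure Omega x -> ~ Omega x -> increases_along Phi x (N x) }.

Lemma barrier_dim0 Omega (phi : V -> R) (lam : {measure set (n.-tuple R) -> \bar R})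
    (kappa : R) : n = 0%N -> Omega !=set0 -> is_lebesgue_measure lam -> 0 < kappa ->
  forall f, (forall x, closure Omega x -> 0 <= f x <= 1) ->
    (\int[lam]_(t in tup2rV @^-1` Omega) (f (tup2rV t))%:E < kappa%:E)%E ->
  barrier Omega (gradient phi) f (fun=> 0) kappa.
Proof.
move=> n0 [x0 Ox0] L k0 f f01.
have all0 (x y : V) : x = y by apply/rowP => i; have := ltn_ord i; rewrite {2}n0.
have OT x : Omega x by rewrite (all0 x x0).
pose B (_ : unit) := box (fun _ : 'I_n => 0 : R) (fun=> 0).
have f0 x : 0 <= f x by have /andP[] := f01 x (subset_closure (OT x)).
have := @integral_ge_disjoint_sum _ _ R lam (tup2rV @^-1` Omega)
  (fun t => (f (tup2rV t))%:E) unit xpredT B (fun=> f x0).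
rewrite (bigD1 tt)//= big1 ?adde0; last by case.
rewrite (_ : lam (B tt) = 1%E) ?mule1; last first.
  rewrite lebesgue_box// (_ : \prod_i _ = 1)// big1// => i _.
  by have := ltn_ord i; rewrite {2}n0.
move=> /(_ _ _ _ _ _ _) H intf; have fk : f x0 < kappa.
  rewrite -lte_fin; apply: le_lt_trans intf; apply: H => //.
  - by move=> t _; rewrite lee_fin.
  - by move=> j; exact: measurable_box.
  - by move=> [] [].
  - by move=> j _ t _; exact: OT.
  - by move=> j t _ _; rewrite (all0 (tup2rV t) x0).
split.
- by apply: continuous_subspaceT; exact: cst_continuous.
- by move=> x _; rewrite normr0 ltW.
- move=> x _; exists (fun=> 0); split.
    by rewrite big1// subr_ge0 (all0 x x0) ltW.
  by move=> i; have := ltn_ord i; rewrite {2}n0.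
- by move=> x _ /(_ (OT x)).
Qed.

Lemma barrier_exists Omega (phi : V -> R) (M : R)
    (lam : {measure set (n.-tuple R) -> \bar R}) (kappa : R) :
  Omega !=set0 -> defining_function Omega phi -> 0 < M ->
  (forall x, closure Omega x -> `|x| <= M) -> is_lebesgue_measure lam -> 0 < kappa ->
  exists2 delta : R, 0 < delta & forall f,
    {within closure Omega, continuous f} ->
    (forall x, closure Omega x -> 0 <= f x <= 1) ->
    (\int[lam]_(t in tup2rV @^-1` Omega) (f (tup2rV t))%:E < delta%:E)%E ->
  exists Phi, barrier Omega (gradient phi) f Phi kappa.
Proof.
move=> O0 dphi M0 OM L k0; have [n0|n0] := posnP n.
  exists kappa => // f _ f01 intf; exists (fun=> 0).
  exact: (barrier_dim0 phi n0 O0 L k0 f01 intf).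
have [z [Z [K [g [[Z0 K0 g0] zc zZ zK zg]]]]] := boundary_barrier O0 dphi M0 OM.
have [G G0 HG] := gradient_bounded M dphi.
pose b : R := Num.min (kappa / (2 * Z)) (kappa / (2 * K)).
have b0 : 0 < b by rewrite lt_min !divr_gt0 ?mulr_gt0.
have bZ : b * Z <= kappa / 2.
  have : b <= kappa / (2 * Z) by rewrite ge_min lexx.
  by rewrite ler_pdivlMr ?mulr_gt0//; clear; lra.
have bK : b * K <= kappa / 2.
  have : b <= kappa / (2 * K) by rewrite ge_min lexx orbT.
  by rewrite ler_pdivlMr ?mulr_gt0//; clear; lra.
have bg0 : 0 < b * g by exact: mulr_gt0.
pose k2 : R := Num.min (kappa / 2) (b * g / 2).
have k20 : 0 < k2 by rewrite lt_min !divr_gt0.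
have k2k : k2 <= kappa / 2 by rewrite ge_min lexx.
have k2g : k2 <= b * g / 2 by rewrite ge_min lexx orbT.
clearbody b k2.
have [delta delta0 Hd] := small_potential O0 dphi M0 OM L n0 G0 k20.
exists delta => // f fc f01 intf.
have [p [pc pk pl pd]] := Hd f fc f01 intf.
exists (fun x => p x + b * z x); split.
- move=> x; exact: (cvgD (pc x) (cvgM (cvg_cst b) (zc x))).
- move=> x cx; apply: le_trans (ler_normD _ _) _.
  rewrite normrM (gtr0_norm b0).
  have : b * `|z x| <= b * Z by rewrite ler_pM2l//; exact: zZ.
  by move: (pk x cx) bZ k2k; clear; lra.
- move=> x cx; have [l [lk lC]] := pl x cx; have [m [mK mC]] := zK x cx.
  exists (fun i => l i + b * m i); split.
    rewrite big_split/= -mulr_sumr.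
    have : b * \sum_i m i <= b * K by rewrite ler_pM2l.
    by move: lk bK k2k; clear; lra.
  move=> i; have [Q CQ [Q0 QS]] := mC i.
  exists (fun r => p (x + r *: ebasis i) + b * Q r).
    exact: (C2at0D (lC i) (C2at0Z b CQ)).
  split; first by rewrite scale0r addr0 Q0.
  by move=> r; rewrite lerD2l ler_pM2l.
- move=> x cx nx; have [Q [c [gc dQ Q0 QS]]] := zg x cx nx.
  have NG : `|- gradient phi x| <= G.
    by rewrite normrN; apply: HG; move: (OM x cx); clear; lra.
  have [d dk dp] := pd x (- gradient phi x) cx NG.
  exists (fun r => p (x + r *: - gradient phi x) + b * Q r), (b * c - d); split.
  + have : b * g <= b * c by rewrite ler_pM2l.
    by move: dk k2g bg0; rewrite ler_norml; clear; lra.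
  + have := is_deriveD dp (is_deriveZ b dQ); rewrite /GRing.scale/=.
    by rewrite mulrN opprB.
  + by rewrite scale0r addr0 Q0.
  + by move=> r; rewrite scalerN lerD2l ler_pM2l.
Qed.

Lemma barrier_comparison Omega N w wt lap f Phi (kappa b A T : R) (s ds : R -> R) :
  open Omega -> compact (closure Omega) ->
  (forall x, closure Omega x -> ~ Omega x ->
    exists2 dl : R, 0 < dl & forall h, 0 < h < dl -> Omega (x - h *: N x)) ->
  regular Omega N w wt lap -> barrier Omega N f Phi kappa -> 0 < A ->
  continuous s -> (forall t, 0 <= t <= T -> 0 < s t) ->
  (forall t : R, 0 < t <= T -> is_derive t 1 s (ds t)) ->
  (forall x, closure Omega x -> w x 0 < (b + A * Phi x) * s 0) ->
  (forall x t, Omega x -> 0 < t <= T -> - kappa <= Phi x <= kappa ->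
     w x t = (b + A * Phi x) * s t -> (b + A * Phi x) * ds t <= wt x t ->
     lap x t <= s t * (A * (kappa - f x)) -> False) ->
  forall x t, closure Omega x -> 0 <= t <= T -> w x t < (b + A * Phi x) * s t.
Proof.
move=> oO cO inw wP [Pc Pn Pa Pi] A0 sc s0 sd w0 nc x t cx tT.
apply: (comparison (S := fun x => b + A * Phi x) (L := fun x => A * (kappa - f x))
  oO cO inw wP _ sc s0 sd _ _ w0 _ cx tT).
- by move=> y; exact: (cvgD (cvg_cst b) (cvgM (cvg_cst A) (Pc y))).
- move=> y Oy; have [l [lk lC]] := Pa y (subset_closure Oy).
  exists (fun i => A * l i); split; first by rewrite -mulr_sumr ler_pM2l.
  move=> i; have [Q CQ [Q0 QS]] := lC i; exists (fun r => b + A * Q r).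
    by have := C2at0D (C2at0_cst b) (C2at0Z A CQ); rewrite add0r.
  by split=> [|r]; [rewrite Q0|rewrite lerD2l ler_pM2l].
- move=> y cy ny; have [Q [c [c0 dQ Q0 QS]]] := Pi y cy ny.
  exists (fun r => b + A * Q r), (A * c); split.
  + exact: mulr_gt0.
  + have := is_deriveD (is_derive_cst b (0 : R) 1) (is_deriveZ A dQ).
    by rewrite add0r /GRing.scale/= mulrN.
  + by rewrite Q0.
  + by move=> r; rewrite lerD2l ler_pM2l.
- move=> y r Oy rT; apply: nc => //.
  by rewrite -ler_norml; apply: Pn; exact: subset_closure.
Qed.

End barriers.

Section affine_functions.
Context {R : realType}.

Lemma is_derive_affine (p q t : R) : is_derive t 1 (fun t => p + q * t) q.
Proof.
have := is_derive_quad p q 0 t; rewrite mulr0 mul0r addr0; congr is_derive.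
by apply/funext => r; rewrite mul0r addr0.
Qed.

Lemma continuous_affine (p q : R) : continuous (fun t : R => p + q * t).
Proof. by move=> t; exact: (cvgD (cvg_cst p) (cvgM (cvg_cst q) cvg_id)). Qed.

Lemma affine_decreasing_itv (p q T t : R) : 0 <= q -> 0 < T -> 0 <= t <= T ->
  p <= p + q + - (q / T) * t <= p + q.
Proof.
move=> q0 T0 /andP[t0 tT].
have qT0 : 0 <= q / T by rewrite divr_ge0// ltW.
have h1 := mulr_ge0 qT0 t0.
have : q / T * t <= q / T * T by rewrite ler_wpM2l.
by rewrite divfK ?gt_eqF//; move: h1; clear; lra.
Qed.

End affine_functions.

Section dynamics.
Context {R : realType} {n : nat}.
Notation V := 'rV[R]_n.

Record barrier_domain (Omega : set V) (N : V -> V) : Prop := BarrierDomain {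
  bd_open : open Omega ;
  bd_compact : compact (closure Omega) ;
  bd_inward : forall x, closure Omega x -> ~ Omega x ->
    exists2 dl : R, 0 < dl & forall h, 0 < h < dl -> Omega (x - h *: N x) ;
  bd_barrier : forall kappa : R, 0 < kappa ->
    exists Phi, barrier Omega N (fun=> 0) Phi kappa }.

Implicit Types (Omega : set V) (N : V -> V) (k : V -> R) (u v ut vt ul vl : V -> R -> R).

Lemma inhibition_itv (x y : R) : 0 <= x -> 1 <= y -> 0 < (1 + x * y)^-1 <= (1 + x)^-1.
Proof.
move=> x0 y1; have xy : x <= x * y by rewrite ler_peMr.
have p1 : 0 < 1 + x by rewrite ltr_pwDl.
have p2 : 0 < 1 + x * y by rewrite ltr_pwDl// (le_trans x0).
by rewrite invr_gt0 p2/= lef_pV2 ?posrE// lerD2l.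
Qed.

Lemma v_nonneg Omega N k u v vt vl (a2 b2 c2 d2 v0 : R) : barrier_domain Omega N ->
  regular Omega N v vt vl -> 0 < a2 -> 0 < b2 -> 0 < c2 -> 0 < d2 -> 0 < v0 ->
  (forall x t, Omega x -> 0 < t -> vt x t = d2 * vl x t
     + a2 * v x t / (1 + k x * u x t) - b2 * v x t ^+ 2 - c2 * u x t * v x t) ->
  (forall x t, closure Omega x -> 0 <= t -> 1 <= u x t) ->
  (forall x, closure Omega x -> 0 <= k x) ->
  (forall x, closure Omega x -> v x 0 = v0) ->
  forall x t, closure Omega x -> 0 <= t -> 0 <= v x t.
Proof.
move=> [oO cO inw barr] vP a20 b20 c20 d20 v00 Ev u1 k0 vi x T cx T0.
rewrite leNgt; apply/negP => vneg.
have [Phi bP] := barr (1 / 2) (divr_gt0 ltr01 (ltr0n R 2)).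
pose K : R := d2 + 3 * a2 + 5 * b2 + 1.
pose sg : R := Num.min 1 (- v x T / 2).
have sg0 : 0 < sg by rewrite lt_min ltr01/= divr_gt0// oppr_gt0.
have sg1 : sg <= 1 by rewrite ge_min lexx.
have sgv : sg <= - v x T / 2 by rewrite ge_min lexx orbT.
pose s (t : R) : R := sg * expR (- (K * T) + K * t).
have ds (t : R) : is_derive t 1 s (K * s t).
  have := @is_derive1_comp R (@expR R) (fun t => - (K * T) + K * t) t _ _
    (is_derive_expR _) (is_derive_affine _ _ _).
  move=> /(is_deriveZ sg); rewrite /GRing.scale/= /s => H.
  rewrite (_ : K * (sg * expR (- (K * T) + K * t)) =
    sg * (expR (- (K * T) + K * t) * K)); last by ring.
  exact: H.
have cs : continuous s.
  move=> t; have [d _] := ds t.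
  by apply: differentiable_continuous; exact/derivable1_diffP.
have s0 t : 0 < s t by rewrite mulr_gt0// expR_gt0.
have K0 : 0 < K by rewrite /K; move: a20 b20 d20; clear; lra.
have sT t : t <= T -> s t <= 1.
  move=> tT; apply: le_trans sg1; rewrite ler_piMr ?(ltW sg0)// -expR0 ler_expR.
  by rewrite addrC subr_le0 ler_pM2l.
have bn := bar_norm bP.
have := @barrier_comparison R n Omega N _ _ _ (fun=> 0) Phi (1 / 2) 1 1 T s
  (fun t => K * s t) oO cO inw (regularN vP) bP ltr01 cs (fun t _ => s0 t) (fun t _ => ds t).
move=> /(_ _ _ x T cx); rewrite lexx T0 => H.
suff : - v x T < (1 + 1 * Phi x) * s T.
  rewrite mul1r.
  have sTE : s T = sg by rewrite /s addNr expR0 mulr1.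
  have := bn x cx; rewrite ler_norml => /andP[_ b1]; rewrite sTE.
  have : (1 + Phi x) * sg <= 3 / 2 * sg.
    by rewrite ler_pM2r//; move: b1; clear; lra.
  by move: sgv vneg; clear; lra.
apply: H => //.
  move=> y cy; rewrite mul1r (vi y cy); apply: lt_trans (_ : 0 < _).
    by rewrite oppr_lt0.
  apply: mulr_gt0 => //; have := bn y cy; rewrite ler_norml; clear; lra.
move=> y t Oy tT bPhi; rewrite !mul1r subr0 => vE.
have t0 : 0 < t by case/andP : tT.
have cy := subset_closure Oy.
have := inhibition_itv (k0 y cy) (u1 y t cy (ltW t0)).
have s1 : s t <= 1 by apply: sT; case/andP : tT.
rewrite (Ev y t Oy t0); move: (s0 t) s1; set S := 1 + Phi y in vE *.
set st := s t in vE *; set q := (_ + _)^-1 => st0 st1 /andP[q0 q1] h1 h2.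
have q1' : q <= 1.
  apply: le_trans q1 _; rewrite invf_le1; last by rewrite ltr_pwDl// k0.
  by rewrite lerDl k0.
have [S0 S1] : 1 / 2 <= S /\ S <= 3 / 2 by rewrite /S; move: bPhi; clear; lra.
set Z := S * st in vE h1 *.
have Z1 : st / 2 <= Z by rewrite /Z; have := ler_wpM2r (ltW st0) S0; clear; lra.
have Z2 : Z <= 3 / 2 * st by rewrite /Z ler_pM2r.
have vZ : v y t = - Z by rewrite -vE opprK.
have Z0 : 0 <= Z by move: Z1 st0; clear; lra.
have uv : 0 <= c2 * u y t * Z.
  rewrite mulr_ge0// mulr_ge0// ?(ltW c20)//.
  by apply: le_trans (u1 y t cy (ltW t0)).
have aq : a2 * Z * q <= a2 * (3 / 2 * st).
  apply: le_trans (_ : a2 * Z <= _); last by rewrite ler_pM2l.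
  by rewrite ler_piMr// mulr_ge0// ltW.
have bZ : b2 * Z ^+ 2 <= b2 * (9 / 4 * st).
  rewrite ler_pM2l// expr2; apply: le_trans (_ : Z * (3 / 2) <= _).
    by rewrite ler_wpM2l//; move: Z2 st1; clear; lra.
  by move: Z2; clear; lra.
have dl : d2 * - vl y t <= d2 * (st * (1 / 2)) by rewrite ler_pM2l// div1r.
have SK : K * (st / 2) <= S * (K * st).
  by rewrite (_ : S * (K * st) = K * Z) ?ler_pM2l//; rewrite /Z; ring.
move: h1; rewrite vZ sqrrN.
rewrite (_ : a2 * - Z / (1 + k y * u y t) = - (a2 * Z * q)); last by rewrite /q; ring.
move: SK aq bZ dl uv st0 (mulr_gt0 b20 st0); rewrite /K; clear; lra.
Qed.

Lemma v_vanishes Omega N k u v vt vl Phi (a2 b2 c2 d2 v0 kappa : R) : barrier_domain Omega N ->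
  regular Omega N v vt vl -> 0 < a2 -> 0 < b2 -> 0 < c2 -> 0 < d2 -> 0 < v0 ->
  (forall x t, Omega x -> 0 < t -> vt x t = d2 * vl x t
     + a2 * v x t / (1 + k x * u x t) - b2 * v x t ^+ 2 - c2 * u x t * v x t) ->
  (forall x t, closure Omega x -> 0 <= t -> 1 <= u x t) ->
  (forall x, closure Omega x -> 0 <= k x) ->
  (forall x, closure Omega x -> v x 0 = v0) ->
  barrier Omega N (fun x => 1 / (1 + k x)) Phi kappa ->
  4 * a2 / d2 * kappa <= 1 / 2 -> 4 * a2 * kappa <= c2 / 4 ->
  forall e : R, 0 < e -> exists2 T0 : R, 0 < T0 &
    forall x t, closure Omega x -> T0 <= t -> v x t < e.
Proof.
move=> [oO cO inw barr] vP a20 b20 c20 d20 v00 Ev u1 k0 vi bP kA kc e0 e00.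
pose A : R := 4 * a2 / d2.
have A0 : 0 < A by rewrite /A divr_gt0// mulr_gt0.
have dA : d2 * A = 4 * a2 by rewrite /A mulrC divfK ?gt_eqF.
rewrite -/A in kA; clearbody A.
pose e : R := e0 / 2; have e1 : 0 < e by rewrite divr_gt0.
pose T0 : R := 12 * v0 / (e * c2) + 1.
have ec0 : 0 < e * c2 by exact: mulr_gt0.
have T00 : 1 < T0 by rewrite ltrDr divr_gt0// mulr_gt0.
exists T0; first exact: lt_trans T00.
move=> x T cx T0T.
have Tgt0 : 0 < T by apply: lt_le_trans T0T; exact: lt_trans T00.
have bn x' : closure Omega x' -> 1 / 2 <= 1 + A * Phi x' <= 3 / 2.
  move=> cx'; have := bar_norm bP cx'; rewrite ler_norml => /andP[h1 h2].
  have := ler_wpM2l (ltW A0) h1; have := ler_wpM2l (ltW A0) h2.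
  by move: kA; clear; lra.
have v20 : 0 <= 2 * v0 by rewrite mulr_ge0// ltW.
pose s (t : R) : R := e + 2 * v0 + - (2 * v0 / T) * t.
have sI t : 0 <= t <= T -> e <= s t <= e + 2 * v0 by exact: affine_decreasing_itv.
have s0 t : 0 <= t <= T -> 0 < s t by move=> /sI /andP[+ _]; exact: lt_le_trans.
have := @barrier_comparison R n Omega N v vt vl _ Phi kappa 1 A T s
  (fun=> - (2 * v0 / T)) oO cO inw vP bP A0 (@continuous_affine R _ _) s0
  (fun t _ => is_derive_affine _ _ t).
move=> /(_ _ _ x T cx); rewrite lexx (ltW Tgt0) => H.
suff : v x T < (1 + A * Phi x) * s T.
  have sTE : s T = e.
    by rewrite /s mulNr divfK ?gt_eqF// addrK.
  have /andP[_ b1] := bn x cx; rewrite sTE => h.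
  have := ler_wpM2r (ltW e1) b1; move: h; rewrite /e.
  by move: e00; clear; lra.
apply: H => //.
  move=> y cy; rewrite (vi y cy) /s mulr0 addr0.
  have /andP[b1 _] := bn y cy.
  have : 1 / 2 * (e + 2 * v0) <= (1 + A * Phi y) * (e + 2 * v0).
    by rewrite ler_wpM2r// addr_ge0// ltW.
  by move: e1; clear; lra.
move=> y t Oy tT bPhi.
have t0 : 0 < t by case/andP : tT.
have cy := subset_closure Oy.
have := inhibition_itv (k0 y cy) (u1 y t cy (ltW t0)).
have tT' : 0 <= t <= T by case/andP : tT => _ ->; rewrite ltW.
have /andP[se _] := sI t tT'; have st0 := s0 t tT'.
have /andP[S0 S1] := bn y cy; have u1' := u1 y t cy (ltW t0).
rewrite (Ev y t Oy t0) div1r; set S := 1 + A * Phi y in S0 S1 *.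
move: (s t) se st0 => st se st0.
set f := (1 + k y)^-1; set q := (_ + _)^-1 => /andP[q0 qf] vE h1 h2.
have Z0 : 0 < v y t by rewrite vE mulr_gt0//; move: S0; clear; lra.
have f0 : 0 < f by exact: lt_le_trans qf.
have aq : a2 * v y t * q <= a2 * (3 / 2) * (st * f).
  apply: le_trans (_ : a2 * v y t * f <= _).
    by rewrite ler_wpM2l// mulr_ge0// ltW.
  rewrite (_ : a2 * (3 / 2) * (st * f) = a2 * (3 / 2 * st) * f); last by ring.
  by rewrite ler_pM2r// ler_pM2l// vE ler_pM2r.
have cu : c2 * (st / 2) <= c2 * u y t * v y t.
  rewrite -mulrA ler_pM2l//; apply: le_trans (_ : v y t <= _).
    by rewrite vE; have := ler_wpM2r (ltW st0) S0; clear; lra.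
  by rewrite ler_peMl// ltW.
have dl : d2 * vl y t <= 4 * a2 * (st * (kappa - f)).
  have := ler_wpM2l (ltW d20) h2.
  rewrite (_ : d2 * (st * (A * (kappa - f))) = d2 * A * (st * (kappa - f))); last by ring.
  by rewrite dA.
have bv : 0 <= b2 * v y t ^+ 2 by rewrite mulr_ge0 ?sqr_ge0// ltW.
have sk : 4 * a2 * kappa * st <= c2 / 4 * st by rewrite ler_pM2r.
have af : 0 < a2 * (st * f) by rewrite !mulr_gt0.
have v20' : 0 < 2 * v0 / T by rewrite divr_gt0// mulr_gt0.
have Sd : - (3 / 2 * (2 * v0 / T)) <= S * - (2 * v0 / T).
  by rewrite mulrN lerN2 ler_pM2r.
have ce : c2 * e <= c2 * st by rewrite ler_pM2l.
have Tv : 12 * v0 / T < e * c2.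
  rewrite ltr_pdivrMr// -ltr_pdivrMl// mulrC.
  by apply: lt_le_trans T0T; rewrite ltrDl.
have vT : 2 * v0 / T = 12 * v0 / T / 6 by field; rewrite gt_eqF.
move: h1; rewrite vT in Sd *.
move: Sd aq cu dl bv sk af ce Tv; clear; lra.
Qed.

Lemma u_upper Omega N u v ut ul (a1 b1 c1 d1 u0 : R) : barrier_domain Omega N ->
  regular Omega N u ut ul -> 0 < a1 -> 0 < b1 -> 0 < c1 -> 0 < d1 -> 1 <= u0 ->
  (forall x t, Omega x -> 0 < t -> ut x t = d1 * ul x t
     + a1 * u x t - b1 * u x t ^+ 2 - c1 * u x t * v x t) ->
  (forall x t, closure Omega x -> 0 <= t -> 0 <= v x t) ->
  (forall x, closure Omega x -> u x 0 = u0) ->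
  forall e : R, 0 < e -> exists2 T0 : R, 0 < T0 &
    forall x t, closure Omega x -> T0 <= t -> u x t < a1 / b1 + e.
Proof.
move=> [oO cO inw barr] uP a10 b10 c10 d10 u01 Eu v0 ui e e0.
have u00 : 0 < u0 by exact: lt_le_trans u01.
pose m : R := a1 / b1; have m0 : 0 < m by exact: divr_gt0.
have mb : b1 * m = a1 by rewrite /m mulrC divfK ?gt_eqF.
rewrite -/m; clearbody m.
pose al : R := m + e / 2; have al0 : 0 < al by rewrite addr_gt0// divr_gt0.
have alE : al = m + e / 2 by []; clearbody al.
pose kappa : R := Num.min (1 / 2) (Num.min (e / 4 / al) (b1 * e / 16 / d1)).
have kp0 : 0 < kappa by rewrite !lt_min !divr_gt0// mulr_gt0.
have kp1 : kappa <= 1 / 2 by rewrite ge_min lexx.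
have kp2 : kappa * al <= e / 4 by rewrite -ler_pdivlMr// !ge_min lexx orbT.
have kp3 : kappa * d1 <= b1 * e / 16 by rewrite -ler_pdivlMr// !ge_min lexx !orbT.
clearbody kappa; have [Phi bP] := barr kappa kp0.
pose T0 : R := 64 * u0 / (a1 * e) + 1.
have ae0 : 0 < a1 * e by exact: mulr_gt0.
have T00 : 1 < T0 by rewrite ltrDr divr_gt0// mulr_gt0.
exists T0; first exact: lt_trans T00.
move=> x T cx T0T.
have Tgt0 : 0 < T by apply: lt_le_trans T0T; exact: lt_trans T00.
have u20 : 0 <= 2 * u0 by rewrite mulr_ge0// ltW.
pose s (t : R) : R := al + 2 * u0 + - (2 * u0 / T) * t.
have sI t : 0 <= t <= T -> al <= s t <= al + 2 * u0 by exact: affine_decreasing_itv.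
have s0 t : 0 <= t <= T -> 0 < s t by move=> /sI /andP[+ _]; exact: lt_le_trans.
have bn x' : closure Omega x' -> 1 - kappa <= 1 + 1 * Phi x' <= 1 + kappa.
  move=> cx'; have := bar_norm bP cx'; rewrite ler_norml mul1r; clear; lra.
have := @barrier_comparison R n Omega N u ut ul (fun=> 0) Phi kappa 1 1 T s
  (fun=> - (2 * u0 / T)) oO cO inw uP bP ltr01 (@continuous_affine R _ _) s0
  (fun t _ => is_derive_affine _ _ t).
move=> /(_ _ _ x T cx); rewrite lexx (ltW Tgt0) => H.
suff : u x T < (1 + 1 * Phi x) * s T.
  have sTE : s T = al by rewrite /s mulNr divfK ?gt_eqF// addrK.
  have /andP[_ b2] := bn x cx; rewrite sTE => h.
  by have := ler_wpM2r (ltW al0) b2; move: h kp2 e0 alE; clear; lra.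
apply: H => //.
  move=> y cy; rewrite (ui y cy) /s mulr0 addr0.
  have /andP[b2 _] := bn y cy.
  have : (1 - kappa) * (al + 2 * u0) <= (1 + 1 * Phi y) * (al + 2 * u0).
    by rewrite ler_wpM2r// addr_ge0// ltW.
  have : 1 / 2 * (al + 2 * u0) <= (1 - kappa) * (al + 2 * u0).
    rewrite ler_wpM2r ?addr_ge0 ?(ltW al0)//; move: kp1; clear; lra.
  by move: al0; clear; lra.
move=> y t Oy tT bPhi.
have t0 : 0 < t by case/andP : tT.
have cy := subset_closure Oy.
have tT' : 0 <= t <= T by case/andP : tT => _ ->; rewrite ltW.
have /andP[se _] := sI t tT'; have st0 := s0 t tT'.
have /andP[S0 S1] := bn y cy; have v0' := v0 y t cy (ltW t0).
rewrite (Eu y t Oy t0); set S := 1 + 1 * Phi y in S0 S1 *.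
move: (s t) se st0 => st se st0; rewrite subr0 mul1r => uE h1 h2.
have Sh : 1 / 2 <= S by move: S0 kp1; clear; lra.
have S2 : S <= 2 by move: S1 kp1; clear; lra.
have uh : st / 2 <= u y t by rewrite uE; have := ler_wpM2r (ltW st0) Sh; clear; lra.
have u0' : 0 < u y t by move: uh st0; clear; lra.
have um : m + e / 4 <= u y t.
  apply: le_trans (_ : (1 - kappa) * al <= _).
    by rewrite mulrBl mul1r; move: kp2 alE; clear; lra.
  rewrite uE; apply: ler_pM => //; [|exact: ltW].
  by move: kp1; clear; lra.
have cuv : 0 <= c1 * u y t * v y t by rewrite !mulr_ge0// ltW.
have bu : b1 * (m + e / 4) * u y t <= b1 * u y t * u y t.
  by rewrite ler_pM2r// ler_pM2l.
have be : b1 * e / 4 * (st / 2) <= b1 * e / 4 * u y t.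
  by rewrite ler_wpM2l// divr_ge0// mulr_ge0// ltW.
have dl : d1 * ul y t <= d1 * (st * kappa) by rewrite ler_pM2l.
have dk : kappa * d1 * st <= b1 * e / 16 * st by rewrite ler_pM2r.
have bs : b1 * m * e <= b1 * e * st.
  rewrite mulrAC ler_wpM2l ?mulr_ge0 ?(ltW b10) ?(ltW e0)//.
  by apply: le_trans se; rewrite alE lerDl divr_ge0// ltW.
have u20' : 0 < 2 * u0 / T by rewrite divr_gt0// mulr_gt0.
have Sd : - (2 * (2 * u0 / T)) <= S * - (2 * u0 / T).
  by rewrite mulrN lerN2 ler_pM2r.
have Tu : 64 * u0 / T < a1 * e.
  rewrite ltr_pdivrMr// -ltr_pdivrMl// mulrC.
  by apply: lt_le_trans T0T; rewrite ltrDl.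
have uT : 2 * u0 / T = 64 * u0 / T / 32 by field; rewrite gt_eqF.
move: h1; rewrite uT in Sd *; rewrite expr2.
have mu : b1 * m * u y t = a1 * u y t by rewrite mb.
move: mu bu; rewrite -{1}mb in Tu *.
move: Sd cuv be dl dk bs Tu; clear; lra.
Qed.

Lemma u_lower Omega N u v ut ul (a1 b1 c1 d1 : R) : barrier_domain Omega N ->
  regular Omega N u ut ul -> 0 < a1 -> 0 < b1 -> 0 < c1 -> 0 < d1 ->
  (forall x t, Omega x -> 0 < t -> ut x t = d1 * ul x t
     + a1 * u x t - b1 * u x t ^+ 2 - c1 * u x t * v x t) ->
  (forall x t, closure Omega x -> 0 <= t -> 1 <= u x t) ->
  (forall e : R, 0 < e -> exists2 T0 : R, 0 < T0 &
    forall x t, closure Omega x -> T0 <= t -> v x t < e) ->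
  forall e : R, 0 < e -> exists2 T : R, 0 < T &
    forall x, closure Omega x -> a1 / b1 - e < u x T.
Proof.
move=> [oO cO inw barr] uP a10 b10 c10 d10 Eu u1 vs e e0.
pose m : R := a1 / b1; have m0 : 0 < m by exact: divr_gt0.
have mb : b1 * m = a1 by rewrite /m mulrC divfK ?gt_eqF.
rewrite -/m; clearbody m.
have [me|me] := leP m (1 + e / 2).
  exists 1 => // x cx; have := u1 x 1 cx ler01; move: me e0; clear; lra.
pose al : R := m - e / 2; have al1 : 1 < al by rewrite /al; move: me; clear; lra.
have al0 : 0 < al by exact: lt_trans al1.
have alE : al = m - e / 2 by []; clearbody al.
pose kappa : R := Num.min (1 / 2) (Num.min (e / 4 / al) (b1 * e / 16 / (d1 * al))).
have kp0 : 0 < kappa by rewrite !lt_min !divr_gt0// mulr_gt0.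
have kp1 : kappa <= 1 / 2 by rewrite ge_min lexx.
have kp2 : kappa * al <= e / 4 by rewrite -ler_pdivlMr// !ge_min lexx orbT.
have kp3 : kappa * (d1 * al) <= b1 * e / 16.
  by rewrite -ler_pdivlMr ?mulr_gt0// !ge_min lexx !orbT.
clearbody kappa; have [Phi bP] := barr kappa kp0.
have be0 : 0 < b1 * e by exact: mulr_gt0.
have [|T1 T10 vT1] := vs (b1 * e / 8 / c1); first by rewrite !divr_gt0.
pose T : R := 4 * al * T1 + 32 * al / (b1 * e) + 1.
have p1 : 0 < 4 * al * T1 by rewrite !mulr_gt0.
have p2 : 0 < 32 * al / (b1 * e) by rewrite divr_gt0// mulr_gt0.
have T0 : 0 < T by rewrite /T; move: p1 p2; clear; lra.
have aT1 : al / T * T1 <= 1 / 4.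
  rewrite mulrAC ler_pdivrMr//; move: p2; rewrite /T; clear; lra.
have aT2 : al / T < b1 * e / 32.
  have : 32 * al / (b1 * e) < T by rewrite /T; move: p1; clear; lra.
  rewrite !ltr_pdivrMr//; clear; lra.
exists T => // x cx.
have aT0 : 0 < al / T by exact: divr_gt0.
pose q : R := (al - 1 / 4) / T.
have qT : q * T = al - 1 / 4 by rewrite /q divfK ?gt_eqF.
have q0 : 0 < q by rewrite divr_gt0//; move: al1; clear; lra.
have qa : q <= al / T by rewrite ler_pM2r ?invr_gt0//; clear; lra.
clearbody q T.
pose s (t : R) : R := 1 / 4 + q * t.
have s0 t : 0 <= t <= T -> 0 < s t.
  by move=> /andP[t0 _]; have := mulr_ge0 (ltW q0) t0; rewrite /s; clear; lra.
have sa t : t <= T -> s t <= al.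
  by move=> tT; have := ler_wpM2l (ltW q0) tT; rewrite qT /s; clear; lra.
have bn x' : closure Omega x' -> - 1 - kappa <= -1 + 1 * Phi x' <= - 1 + kappa.
  move=> cx'; have := bar_norm bP cx'; rewrite ler_norml mul1r; clear; lra.
have := @barrier_comparison R n Omega N _ _ _ (fun=> 0) Phi kappa (- 1) 1 T s
  (fun=> q) oO cO inw (regularN uP) bP ltr01 (@continuous_affine R _ _) s0
  (fun t _ => is_derive_affine _ _ t).
move=> /(_ _ _ x T cx); rewrite lexx (ltW T0) => H.
suff : - u x T < (-1 + 1 * Phi x) * s T.
  have sTE : s T = al by rewrite /s qT addrC subrK.
  have /andP[_ b2] := bn x cx; rewrite sTE => h.
  by have := ler_wpM2r (ltW al0) b2; move: h kp2 e0 alE; clear; lra.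
apply: H => //.
  move=> y cy; rewrite /s mulr0 addr0; have := u1 y 0 cy (lexx 0).
  have /andP[b2 _] := bn y cy; move: b2 kp1; clear; lra.
move=> y t Oy tT bPhi.
have /andP[t0 tT'] := tT.
have cy := subset_closure Oy.
have tT'' : 0 <= t <= T by rewrite (ltW t0).
have /andP[S0 S1] := bn y cy; have u1' := u1 y t cy (ltW t0).
have st0 := s0 t tT''; have sal := sa t tT'.
rewrite (Eu y t Oy t0); set S := -1 + 1 * Phi y in S0 S1 *.
rewrite subr0 mul1r => uE h1 h2.
have uE' : u y t = - S * s t by rewrite mulNr -uE opprK.
have NS : - S <= 1 + kappa by move: S0; clear; lra.
have ule : u y t <= (1 + kappa) * s t by rewrite uE' ler_pM2r.
have [tT1|tT1] := leP t T1.
  have qt : q * t <= 1 / 4.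
    apply: le_trans aT1; apply: ler_pM => //; exact: ltW.
  have : (1 + kappa) * s t <= 3 / 2 * s t by rewrite ler_pM2r//; move: kp1; clear; lra.
  by move: ule u1' qt; rewrite /s; clear; lra.
have vlt := vT1 y t cy (ltW tT1); rewrite ltr_pdivlMr// in vlt.
move: (s t) st0 sal uE uE' h1 h2 ule => st st0 sal uE uE' h1 h2 ule.
have um : u y t <= m - e / 4.
  apply: le_trans ule _; apply: le_trans (_ : (1 + kappa) * al <= _).
    by rewrite ler_pM2l//; move: kp0; clear; lra.
  by rewrite mulrDl mul1r; move: kp2 alE; clear; lra.
have rate : b1 * e / 8 <= a1 - b1 * u y t - c1 * v y t.
  have : b1 * u y t <= b1 * (m - e / 4) by rewrite ler_pM2l.
  by rewrite mulrBr mb; move: vlt; clear; lra.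
have growth : b1 * e / 8 <= u y t * (a1 - b1 * u y t - c1 * v y t).
  apply: (le_trans rate); rewrite ler_peMl//; apply: le_trans rate.
  by rewrite divr_ge0// ltW.
have dl : - (d1 * (st * kappa)) <= d1 * ul y t.
  by rewrite -mulrN ler_pM2l// lerNl.
have dk : d1 * (st * kappa) <= b1 * e / 16.
  apply: le_trans kp3; rewrite (_ : d1 * (st * kappa) = kappa * (d1 * st)); last by ring.
  by rewrite ler_pM2l// ler_pM2l.
have Sq : - (2 * q) <= S * q.
  by rewrite -mulNr ler_pM2r//; move: S0 kp1; clear; lra.
move: h1 growth; rewrite expr2.
move: dl dk Sq qa aT2 be0; clear; lra.
Qed.

End dynamics.

Theorem mainTheorem18 (R : realType) (n : nat) (Omega : set 'rV[R]_n)
  (lam : {measure set (n.-tuple R) -> \bar R})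
  (a1 a2 b1 b2 c1 c2 d1 d2 : R) :
  bounded_C1_domain Omega ->
  is_lebesgue_measure lam ->
  0 < a1 -> 0 < a2 -> 0 < b1 -> 0 < b2 -> 0 < c1 -> 0 < c2 -> 0 < d1 -> 0 < d2 ->
  c2 / b1 < a2 / a1 -> a2 / a1 < b2 / c1 -> c1 * c2 < b1 * b2 ->
  let kc := (a2 * b1 ^+ 2 - c2 * a1 * b1) / (a1 ^+ 2 * c2) in
  exists C1 : R, 0 < C1 /\
  forall (k : 'rV[R]_n -> R) (u v : 'rV[R]_n -> R -> R) (u0 v0 : R)
         (ustar : 'rV[R]_n -> R),
    standing_k Omega lam k ->
    solves_system Omega k a1 a2 b1 b2 c1 c2 d1 d2 u v ->
    1 <= u0 -> 0 < v0 ->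
    (forall x, closure Omega x -> u x 0 = u0 /\ v x 0 = v0) ->
    (forall x, closure Omega x -> forall s t, 0 <= s -> s <= t -> u x s <= u x t) ->
    (forall x, closure Omega x -> u x t @[t --> +oo] --> ustar x) ->
    (* C1/|Omega| * int_Omega 1/(1+k) < 1/(1 + kc a1/b1), multiplied by |Omega| *)
    (C1%:E * \int[lam]_(y in tup2rV @^-1` Omega) (1 / (1 + k (tup2rV y)))%:E
       < lam (tup2rV @^-1` Omega) * (1 / (1 + kc * (a1 / b1)))%:E)%E ->
    forall eps : R, 0 < eps -> exists T : R, forall t, T <= t -> forall x, Omega x ->
      `|u x t - a1 / b1| < eps /\ `|v x t| < eps.
Proof.
move=> [oO bdom] L a10 a20 b10 b20 c10 c20 d10 d20 weak1 _ _ kc.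
have [_ [neO [bO [phi dphi]]]] := bdom.
have [M M0 OM] := bounded_closure bO.
have cO := compact_closure_domain OM.
have inw := inward_domain dphi.
have BD : barrier_domain Omega (gradient phi).
  split=> // kappa k0.
  have [delta delta0 H] := barrier_exists neO dphi M0 OM L k0.
  apply: H; first by apply: continuous_subspaceT; exact: cst_continuous.
    by move=> x _; rewrite lexx ler01.
  by rewrite integral0_eq// lte_fin.
pose A : R := 4 * a2 / d2; have A0 : 0 < A by rewrite divr_gt0// mulr_gt0.
pose kappa : R := Num.min (1 / 2 / A) (c2 / 4 / (4 * a2)).
have kappa0 : 0 < kappa by rewrite lt_min !divr_gt0// mulr_gt0.
have kA : A * kappa <= 1 / 2 by rewrite mulrC -ler_pdivlMr// ge_min lexx.
have kc2 : 4 * a2 * kappa <= c2 / 4.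
  by rewrite mulrC -ler_pdivlMr ?mulr_gt0// ge_min lexx orbT.
have [delta delta0 barr] := barrier_exists neO dphi M0 OM L kappa0.
have kc0 : 0 < kc.
  rewrite divr_gt0 ?mulr_gt0 ?exprn_gt0//.
  move: weak1; rewrite ltr_pdivrMr// mulrAC ltr_pdivlMr// => h.
  rewrite (_ : _ - _ = b1 * (a2 * b1 - c2 * a1)); last by ring.
  by rewrite mulr_gt0// subr_gt0.
pose rho : R := 1 / (1 + kc * (a1 / b1)).
have rho0 : 0 < rho by rewrite divr_gt0// addr_gt0// mulr_gt0// divr_gt0.
pose W : R := (2 * M) ^+ n; have W0 : 0 < W by rewrite exprn_gt0// mulr_gt0.
exists (W * rho / delta); split; first by rewrite divr_gt0// mulr_gt0.
move=> k u v u0 v0 ustar [kd [_ [k0 _]]] [uC [vC [Eu Ev]]] u01 v00 ini umono _ intk e e0.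
have uP := C21_regular oO dphi uC; have vP := C21_regular oO dphi vC.
have u1 x t : closure Omega x -> 0 <= t -> 1 <= u x t.
  move=> cx t0; apply: le_trans (umono x cx 0 t (lexx 0) t0).
  by rewrite (ini x cx).1.
have v0i x (cx : closure Omega x) := (ini x cx).2.
have u0i x (cx : closure Omega x) := (ini x cx).1.
have f01 x : closure Omega x -> 0 <= 1 / (1 + k x) <= 1.
  move=> cx; have k1 : 0 < 1 + k x by rewrite ltr_pwDl// k0.
  by rewrite divr_ge0 ?(ltW k1)//= ler_pdivrMr// mul1r lerDl k0.
have fc : {within closure Omega, continuous (fun x => 1 / (1 + k x))}.
  apply: continuous_in_subspaceT => x; rewrite inE => cx.
  have ck : k @ x --> k x by exact: differentiable_continuous (kd x cx).
  have k1 : 1 + k x != 0 by rewrite gt_eqF// ltr_pwDl// k0.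
  have ck1 : (fun y => 1 + k y) @ x --> 1 + k x by exact: (cvgD (cvg_cst (1 : R)) ck).
  have ckV : (fun y => (1 + k y)^-1) @ x --> (1 + k x)^-1 by exact: (cvgV k1 ck1).
  exact: (cvgM (cvg_cst (1 : R)) ckV).
have lamO : (lam (tup2rV @^-1` Omega) <= W%:E)%E.
  apply: lebesgue_bounded_open => //; last exact: ltW.
  by move=> x Ox; apply: OM; exact: subset_closure.
have intf : (\int[lam]_(y in tup2rV @^-1` Omega) (1 / (1 + k (tup2rV y)))%:E < delta%:E)%E.
  have C0 : 0 < W * rho / delta by rewrite divr_gt0// mulr_gt0.
  rewrite -(@lte_pmul2l _ (W * rho / delta)%:E) ?lte_fin//.
  apply: (lt_le_trans intk); rewrite -EFinM divfK ?gt_eqF// (EFinM W).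
  by apply: lee_wpmul2r => //; rewrite lee_fin ltW.
have [Phi bP] := barr _ fc f01 intf.
have v_ge0 := v_nonneg BD vP a20 b20 c20 d20 v00 Ev u1 k0 v0i.
have v_to0 := v_vanishes BD vP a20 b20 c20 d20 v00 Ev u1 k0 v0i bP kA kc2.
have [T1 T10 uT1] := u_upper BD uP a10 b10 c10 d10 u01 Eu v_ge0 u0i e0.
have [T2 T20 uT2] := u_lower BD uP a10 b10 c10 d10 Eu u1 v_to0 e0.
have [T3 T30 vT3] := v_to0 e e0.
exists (Num.max T1 (Num.max T2 T3)) => t; rewrite !ge_max => /and3P[t1 t2 t3] x Ox.
have cx := subset_closure Ox.
have t0 : 0 <= t by exact: le_trans (ltW T10) t1.
split; last by rewrite ger0_norm ?v_ge0//; exact: vT3.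
have lower := lt_le_trans (uT2 x cx) (umono x cx T2 t (ltW T20) t2).
by rewrite ltr_norml ltrBlDl (uT1 x t cx t1) andbT ltrBrDl.
Qed.
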